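(* There exist transcendental entire functions $f$ and $g$ and infinitely many domains in $\mathbb{C}$, each of which lies in a periodic component of $F(f)$ and in a periodic component of $F(g)$, but lies in a wandering component of $F(g\circ f)$ and in a wandering component of $F(f\circ g)$.
   Context: A domain is a nonempty open connected subset of $\mathbb{C}$. For a transcendental entire function $h$, $h^n$ denotes its $n$-th iterate, and the Fatou set is $F(h)=\{z\in\mathbb{C}: \{h^n\}_{n\in\mathbb{N}} \text{ is normal in some neighborhood of } z\}$. A component of $F(h)$ means a connected component. For a component $U$ of $F(h)$ and $k\ge 0$, let $U_k$ denote the component of $F(h)$ containing $h^k(U)$ (so $U_0=U$). The component $U$ is called wandering if $U_k\cap U_l=\emptyset$ for all $k\neq l$; otherwise it is called preperiodic. It is called periodic if $U_k=U$ for some $k\ge 1$. A domain lies in a wandering (resp. periodic, preperiodic) component of $h$ if it is contained in some wandering (resp. periodic, preperiodic) component of $F(h)$. If $f,g$ are transcendental entire, so are $f\circ g$ and $g\circ f$, and these notions apply to them. *)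

(* Defs.v *)
From HB Require Import structures.
From mathcomp Require Import all_boot all_order all_algebra.
From mathcomp Require Import complex.
From mathcomp Require Import all_classical all_reals all_analysis.

Set Implicit Arguments.
Unset Strict Implicit.
Unset Printing Implicit Defensive.

Import Order.TTheory GRing.Theory Num.Theory.
Import numFieldNormedType.Exports.
Local Open Scope classical_set_scope.
Local Open Scope ring_scope.
Local Open Scope complex_scope.

Section Dynamics.
Variable R : realType.
(* MathComp-Analysis equips the regular algebra R[i]^o, not R[i] itself, with
   the topology of the modulus and the structure of a normed R[i]-module. *)
Local Notation C := (R[i]^o).
Implicit Types (f h : C -> C) (D U V : set C).

Definition domain D := [/\ D !=set0, open D & connected D].

(* Derivability in direction 1 over the base field R[i] is complex
   differentiability. *)
Definition entire f := forall z : C, derivable f z 1.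

Definition transcendental_entire f :=
  entire f /\ ~ exists p : {poly R[i]}, forall z, f z = p.[z].

(* Chordal distance on the Riemann sphere, [None] being the point at
   infinity. *)
Definition chordal (p q : option C) : R :=
  let m (z : C) : R := complex.Re `|z| in
  match p, q with
  | Some z, Some w =>
      2 * m (z - w) / (Num.sqrt (1 + m z ^+ 2) * Num.sqrt (1 + m w ^+ 2))
  | Some z, None | None, Some z => 2 / Num.sqrt (1 + m z ^+ 2)
  | None, None => 0
  end.

Definition sphere_cvg_locally_uniformly
    D (u : nat -> C -> C) (l : C -> option C) :=
  forall z, D z -> exists2 V, nbhs z V &
    forall e : R, 0 < e -> \forall n \near \oo,
      forall w, V w -> chordal (Some (u n w)) (l w) < e.

(* The limit may take the value infinity, as is usual in Montel's sense. *)
Definition normal_family D (F : set (C -> C)) :=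
  forall u : nat -> C -> C, (forall n, F (u n)) ->
    exists s : nat -> nat, {homo s : m n / (m < n)%N} /\
      exists l : C -> option C, sphere_cvg_locally_uniformly D (u \o s) l.

Definition Fatou h : set C :=
  [set z | exists2 D, open_nbhs z D &
    normal_family D (range (fun n : nat => iter n h))].

Definition fatou_component h U :=
  exists2 z, Fatou h z & U = connected_component (Fatou h) z.

(* V is U_k. *)
Definition component_of_image h U (k : nat) V :=
  fatou_component h V /\ iter k h @` U `<=` V.

Definition wandering_component h U :=
  fatou_component h U /\
  exists U_ : nat -> set C,
    (forall k, component_of_image h U k (U_ k)) /\
    forall k l : nat, k <> l -> U_ k `&` U_ l = set0.

Definition periodic_component h U :=
  fatou_component h U /\
  exists2 k : nat, (1 <= k)%N & component_of_image h U k U.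

Definition lies_in (P : set C -> Prop) D := exists2 U, P U & D `<=` U.

End Dynamics.

(* Main.v *)
Require Import Defs.
From mathcomp Require Import all_boot all_order all_algebra.
From mathcomp Require Import complex.
From mathcomp Require Import all_classical all_reals all_analysis.
From mathcomp Require Import ring lra.

(** The functions are explicit. Let [F z = z + sin z] ([sine_drift] below). It
    is odd, it commutes with the translation by [2 pi], and every odd multiple
    [p] of [pi] is a super-attracting fixed point, because [sin p = 0] and
    [cos p = -1]. Put [f z = - F z] and [g z = 2 pi - F z], which are
    [reflected_drift 0] and [reflected_drift (2 pi)]. The map [f] exchanges [p]
    and [- p], and [g] exchanges [p] and [2 pi - p], both contracting small
    disks around these points, so a small disk around [pi] lies in a periodic
    component of either map. But the oddness and the translation symmetry of [F]
    give [g (f z) = F (F z) + 2 pi] and [f (g z) = F (F z) - 2 pi]: composing the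
    two point reflections of the odd multiples of [pi] gives a translation, under
    which the disk escapes along the real axis. Any sequence of smaller
    concentric disks supplies the infinitely many domains.

    What has to be shown is that the components visited by the escaping disk are
    distinct. They are separated by the vertical lines [Re z = 2 k pi], which
    contain no Fatou point ([not_Fatou_vertical_line]). On such a line
    [x = 2 k pi] is invariant under [F], so its points escape under
    [F o F + c], [c] being [2 pi] or [- 2 pi]. It is thus enough to find points
    arbitrarily close to [2 k pi + i y], with [y <> 0], whose orbits return to a
    fixed disk at arbitrarily late times: locally uniform limits of iterates in
    the chordal metric then cannot exist ([not_Fatou_escaping]). Take [k = 0] and
    [y > 0] and start from [s + i y] with [s > 0] small. The real part grows
    geometrically under [F], and the imaginary part increases, until the real
    part passes [pi / 2], where the imaginary part may jump below zero. By the
    intermediate value theorem, some small [s] has an iterate that is exactly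
    real, and it is then a large positive number ([real_landing]). From there on
    the [F]-orbit remains in an interval between consecutive multiples of
    [2 pi], while the translations by [- 2 pi] accumulate and bring the point
    back to [[0, 2 pi]]. The other cases follow by the symmetries of [F].

    Finally, for iterates of a component to lie in components at all, the Fatou
    set has to be forward invariant. The general argument needs open maps; here
    [F] is strictly differentiable with derivative [1 + cos z], hence open at
    its noncritical points by Newton iteration ([open_at_strict]), whereas its
    critical points are the odd multiples of [pi], whose images are Fatou points
    by the first paragraph. *)

Set Implicit Arguments.
Unset Strict Implicit.
Unset Printing Implicit Defensive.

Import Order.TTheory GRing.Theory Num.Theory.
Import numFieldNormedType.Exports.
Local Open Scope classical_set_scope.
Local Open Scope ring_scope.
Local Open Scope complex_scope.

#[local] Arguments chordal : simpl never.

(** * The modulus and the topology of the complex plane *)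

Section Modulus.
Variable R : realType.
Local Notation C := (R[i]^o).
Implicit Types (z w v : C) (V : set C).
Local Notation Re := (@complex.Re R).
Local Notation Im := (@complex.Im R).

Definition cmod z : R := Re `|z|.

Lemma cmodE z : cmod z = Num.sqrt (Re z ^+ 2 + Im z ^+ 2).
Proof. by rewrite /cmod normc_def. Qed.

Lemma normE_cmod z : `|z| = (cmod z)%:C.
Proof. by rewrite /cmod normc_def. Qed.

Lemma cmodD z w : cmod (z + w) <= cmod z + cmod w.
Proof. by rewrite -lecR rmorphD /= -!normE_cmod ler_normD. Qed.

Lemma cmodN z : cmod (- z) = cmod z.
Proof. by rewrite /cmod normrN. Qed.

Lemma cmodM z w : cmod (z * w) = cmod z * cmod w.
Proof. by apply: complexI; rewrite rmorphM /= -!normE_cmod normrM. Qed.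

Lemma cmod0 : cmod 0 = 0.
Proof. by rewrite /cmod normr0. Qed.

Lemma ReIm_eq z w : Re z = Re w -> Im z = Im w -> z = w.
Proof. by case: z w => [a b] [c d] /= -> ->. Qed.

Lemma cmod_distC z w : cmod (z - w) = cmod (w - z).
Proof. by rewrite -cmodN opprB. Qed.

Lemma cmod_dist_triangle v z w : cmod (z - w) <= cmod (z - v) + cmod (v - w).
Proof. by apply: le_trans (cmodD _ _); rewrite addrA subrK. Qed.

Lemma cmod_ge0 z : 0 <= cmod z.
Proof. by rewrite cmodE; exact: sqrtr_ge0. Qed.

Lemma abs_Re_le z : `|Re z| <= cmod z.
Proof.
rewrite cmodE; rewrite -sqrtr_sqr ler_sqrt ?lerDl ?sqr_ge0//.
by rewrite addr_ge0 ?sqr_ge0.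
Qed.

Lemma abs_Im_le z : `|Im z| <= cmod z.
Proof.
rewrite cmodE; rewrite -sqrtr_sqr ler_sqrt ?lerDr ?sqr_ge0//.
by rewrite addr_ge0 ?sqr_ge0.
Qed.

Lemma cmod_le_ReIm z : cmod z <= `|Re z| + `|Im z|.
Proof.
rewrite cmodE; case: z => a b /=.
rewrite -(@ler_pXn2r _ 2) ?nnegrE ?sqrtr_ge0 ?addr_ge0// sqr_sqrtr.
  rewrite sqrrD !real_normK ?num_real// addrAC lerDl.
  by rewrite mulrn_wge0// mulr_ge0.
by rewrite addr_ge0 ?sqr_ge0.
Qed.

Lemma cmod_real (a : R) : cmod (a%:C) = `|a|.
Proof. by rewrite cmodE /= expr0n addr0 sqrtr_sqr. Qed.

Lemma cmod_eq0 z : (cmod z == 0) = (z == 0).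
Proof.
by rewrite -(inj_eq (@complexI R)) -normE_cmod normr_eq0.
Qed.

Lemma cmod_gt0 z : (0 < cmod z) = (z != 0).
Proof. by rewrite lt_def cmod_ge0 andbT cmod_eq0. Qed.

(** The topology of the complex plane is that of a normed module over the
    complex numbers, whose radii are themselves complex; everything below
    measures distances by a real modulus. *)
Lemma nbhs_cmod z V :
  nbhs z V <-> exists2 r : R, 0 < r & forall w, cmod (w - z) < r -> V w.
Proof.
split.
- move=> /nbhs_ballP[e /= e0 eV]; exists (Re e).
    by move: e0; rewrite ltcE /= => /andP[].
  move=> w wz; apply: eV; rewrite /ball /= /ball_ normE_cmod ltcE /=.
  move: e0; rewrite ltcE /= => /andP[/eqP -> _].
  by rewrite eqxx /= cmod_distC.
- move=> [r r0 rV]; apply/nbhs_ballP; exists r%:C; first by rewrite /= ltcR.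
  by move=> w; rewrite /ball /= /ball_ normE_cmod ltcR cmod_distC => /rV.
Qed.

Lemma open_cmod V :
  open V <-> forall z, V z ->
    exists2 r : R, 0 < r & forall w, cmod (w - z) < r -> V w.
Proof.
rewrite openE; split=> [VV z /VV|VV z /VV]; rewrite /interior.
  by move/nbhs_cmod.
by move=> ?; apply/nbhs_cmod.
Qed.

Lemma continuous_cmod (f : C -> C) z :
  {for z, continuous f} <->
  forall e : R, 0 < e -> exists2 d : R, 0 < d &
    forall w, cmod (w - z) < d -> cmod (f w - f z) < e.
Proof.
split=> [fz e e0|fz].
  have : nbhs (f z) [set w : C | cmod (w - f z) < e].
    by apply/nbhs_cmod; exists e.
  by move=> /fz /nbhs_cmod.
move=> V /nbhs_cmod[r r0 rV]; apply/nbhs_cmod.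
by have [d d0 dr] := fz _ r0; exists d => // w /dr /rV.
Qed.

Lemma continuous_Re : continuous (Re : C -> R).
Proof.
move=> z V /nbhs_ballP[e /= e0 eV]; apply/nbhs_cmod; exists e => // w wz.
apply: eV; rewrite /ball /= distrC; apply: le_lt_trans wz.
by have := abs_Re_le (w - z); case: (w) (z) => [? ?] [].
Qed.

Definition cball z (r : R) : set C := [set w | cmod (w - z) < r].

Lemma cball_open z r : open (cball z r).
Proof.
apply/open_cmod => w zw; exists (r - cmod (w - z)); first by rewrite subr_gt0.
move=> v vw; rewrite /cball /=; apply: le_lt_trans (cmod_dist_triangle w _ _) _.
by rewrite -ltrBrDr.
Qed.

Lemma cball_center z r : 0 < r -> cball z r z.
Proof. by move=> r0; rewrite /cball /= subrr cmod0. Qed.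

(** A disk is the union of the segments issued from its centre. *)
Lemma cball_connected z r : connected (cball z r).
Proof.
have [r0|r0] := ltP 0 r; last first.
  suff -> : cball z r = set0 by exact: connected0.
  apply/seteqP; split=> // w /=; rewrite /cball /=.
  by have := cmod_ge0 (w - z); lra.
pose seg w := (fun t : R => z + t%:C * (w - z) : C) @` `[0, 1].
have -> : cball z r = \bigcup_(w in cball z r) seg w.
  apply/seteqP; split=> [w zw|w [v zv [t /= /[!in_itv]/= /andP[t0 t1] <-]]].
    exists w => //; exists 1; first by rewrite /= in_itv /= lexx ler01.
    by rewrite mul1r addrC subrK.
  rewrite /cball /= [z + _]addrC addrK cmodM cmod_real ger0_norm//.
  by apply: le_lt_trans zv; rewrite ler_piMl ?cmod_ge0.
apply: bigcup_connected.
  exists z => w _; exists 0; first by rewrite /= in_itv /= lexx ler01.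
  by rewrite mul0r addr0.
move=> w _; apply: connected_continuous_connected; first exact: segment_connected.
apply: continuous_subspaceT => t V /nbhs_cmod[e e0 eV]; apply/nbhs_ballP.
have N0 : 0 < cmod (w - z) + 1 by rewrite ltr_wpDl ?cmod_ge0.
exists (e / (cmod (w - z) + 1)); first by rewrite /= divr_gt0.
move=> s; rewrite /ball /= ltr_pdivlMr// => ts; apply: eV.
have -> : z + s%:C * (w - z) - (z + t%:C * (w - z)) = (s - t)%:C * (w - z).
  by rewrite rmorphB /=; ring.
rewrite cmodM cmod_real distrC; apply: le_lt_trans ts.
by rewrite ler_wpM2l// lerDl.
Qed.

End Modulus.
(** * The chordal metric *)

Section Chordal.
Variable R : realType.
Local Notation C := (R[i]^o).
Implicit Types (z w v : C) (p q r : option C).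
Local Notation Re := (@complex.Re R).
Local Notation Im := (@complex.Im R).

(** Coordinates of the stereographic projection to the unit sphere. *)
Definition stereo p : R * R * R :=
  if p is Some z then
    let s := 1 + (Re z ^+ 2 + Im z ^+ 2) in
    (2 * Re z / s, 2 * Im z / s, 1 - 2 / s)
  else (0, 0, 1).

Definition dist2 (u v : R * R * R) : R :=
  (u.1.1 - v.1.1) ^+ 2 + (u.1.2 - v.1.2) ^+ 2 + (u.2 - v.2) ^+ 2.

Lemma cmod_sqr z : cmod z ^+ 2 = Re z ^+ 2 + Im z ^+ 2.
Proof. by rewrite cmodE sqr_sqrtr// addr_ge0// sqr_ge0. Qed.

Lemma chordal_ge0 p q : 0 <= chordal p q.
Proof.
case: p q => [z|] [w|] //=; rewrite divr_ge0 ?mulr_ge0 ?sqrtr_ge0//.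
exact: (cmod_ge0 (z - w)).
Qed.

(** The chordal distance is the Euclidean distance between stereographic
    projections, so it inherits a triangle inequality; squaring both avoids
    radicals and costs only a constant factor. *)
Lemma chordal_sqr p q : chordal p q ^+ 2 = dist2 (stereo p) (stereo q).
Proof.
have pos z : 0 < 1 + (Re z ^+ 2 + Im z ^+ 2).
  by rewrite ltr_pwDl ?addr_ge0 ?sqr_ge0.
case: p q => [z|] [w|]; rewrite /dist2 /stereo /chordal -?/(cmod _) ?subrr
  ?exprMn ?exprVn ?exprMn ?sqr_sqrtr ?cmod_sqr ?(ltW (pos _)) ?subr0 ?sub0r//=.
- have := pos z; have := pos w; case: z w => [a b] [c d] /= /lt0r_neq0 h1
    /lt0r_neq0 h2.
  by field; rewrite h1 h2.
- have := pos z; case: z => [a b] /= /lt0r_neq0 h1.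
  by field; rewrite h1.
- have := pos w; case: w => [a b] /= /lt0r_neq0 h1.
  by field; rewrite h1.
- by rewrite expr0n /= !addr0.
Qed.

Lemma chordal_sym p q : chordal p q = chordal q p.
Proof.
apply/eqP; rewrite -(@eqrXn2 _ 2)// ?chordal_ge0// !chordal_sqr /dist2.
by apply/eqP; ring.
Qed.

(** Squares satisfy [(a - c)^2 <= 2 (a - b)^2 + 2 (b - c)^2] in each coordinate,
    whence the factor [2]. *)
Lemma chordal_triangle q p r e :
  chordal p q < e -> chordal q r < e -> chordal p r < 2 * e.
Proof.
move=> pq qr; have e0 : 0 <= e by apply: ltW; apply: le_lt_trans pq; exact: chordal_ge0.
have sqr_lt p1 p2 b : chordal p1 p2 < b -> dist2 (stereo p1) (stereo p2) < b ^+ 2.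
  move=> lt_b; rewrite -chordal_sqr ltr_sqr ?nnegrE ?chordal_ge0//.
  by apply: ltW; apply: le_lt_trans lt_b; exact: chordal_ge0.
rewrite -ltr_sqr ?nnegrE ?chordal_ge0 ?mulr_ge0// chordal_sqr.
move: (sqr_lt _ _ _ pq) (sqr_lt _ _ _ qr); rewrite /dist2.
move: (stereo p) (stereo q) (stereo r).
move=> [[a1 a2] a3] [[b1 b2] b3] [[c1 c2] c3] /= dpq dqr.
have sq (a b c : R) : (a - c) ^+ 2 <= 2 * (a - b) ^+ 2 + 2 * (b - c) ^+ 2.
  rewrite -subr_ge0.
  suff -> : 2 * (a - b) ^+ 2 + 2 * (b - c) ^+ 2 - (a - c) ^+ 2 =
    (a + c - 2 * b) ^+ 2 by exact: sqr_ge0.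
  by ring.
rewrite exprMn.
have := sq a1 b1 c1; have := sq a2 b2 c2; have := sq a3 b3 c3; lra.
Qed.

Lemma chordalxx p : chordal p p = 0.
Proof.
apply/eqP; rewrite -sqrf_eq0 chordal_sqr /dist2 !subrr expr0n /=.
by rewrite !addr0.
Qed.

Lemma chordal_eq p q : (forall e, 0 < e -> chordal p q < e) -> p = q.
Proof.
move=> h; have : chordal p q = 0.
  apply/eqP; rewrite eq_le chordal_ge0 andbT leNgt; apply/negP => /h.
  by rewrite ltxx.
case: p q {h} => [z|] [w|] //= /eqP; rewrite !mulf_eq0 ?invr_eq0 ?mulf_eq0 ?pnatr_eq0/=
  ?sqrtr_eq0 ?leNgt ?ltr_pwDl ?sqr_ge0//= ?orbF -?/(cmod _).
by rewrite cmod_eq0 subr_eq0 => /eqP ->.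
Qed.

Lemma sqrt1D_ge1 (a : R) : 1 <= Num.sqrt (1 + a ^+ 2).
Proof. by rewrite -[leLHS]sqrtr1 ler_sqrt ?lerDl ?sqr_ge0// addr_ge0 ?sqr_ge0. Qed.

Lemma sqrt1D_gt0 (a : R) : 0 < Num.sqrt (1 + a ^+ 2).
Proof. exact: lt_le_trans ltr01 (sqrt1D_ge1 a). Qed.

Lemma chordal_le_cmod z w : chordal (Some z) (Some w) <= 2 * cmod (z - w).
Proof.
rewrite /chordal -?/(cmod _) ler_pdivrMr.
  rewrite ler_peMr ?mulr_ge0 ?cmod_ge0// -[leLHS]mulr1.
  by apply: ler_pM => //; exact: sqrt1D_ge1.
by rewrite mulr_gt0 ?sqrt1D_gt0.
Qed.

Lemma chordal_infty_lt (e : R) z : 0 < e -> 2 / e < cmod z ->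
  chordal (Some z) None < e.
Proof.
move=> e0 ez; rewrite /chordal -?/(cmod _) ltr_pdivrMr; last first.
  exact: sqrt1D_gt0.
rewrite -ltr_pdivrMl// mulrC; apply: lt_le_trans ez _.
rewrite -[leLHS]ger0_norm ?cmod_ge0// -sqrtr_sqr ler_sqrt ?lerDr//.
by rewrite addr_ge0 ?sqr_ge0.
Qed.

Lemma chordal_infty_gt (M : R) z : cmod z <= M ->
  2 / Num.sqrt (1 + M ^+ 2) <= chordal (Some z) None.
Proof.
move=> zM; rewrite /chordal -?/(cmod _).
rewrite ler_pM2l// lef_pV2 ?posrE ?sqrt1D_gt0// ler_sqrt ?addr_ge0 ?sqr_ge0// lerD2l.
by rewrite ler_sqr ?nnegrE ?cmod_ge0// (le_trans _ zM)// cmod_ge0.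
Qed.

End Chordal.
(** * Normal families of iterates *)

Section Subsequences.

Definition frequently (P : nat -> Prop) := forall N, exists2 n, (N <= n)%N & P n.

Lemma homo_ltn_ge_id (s : nat -> nat) :
  {homo s : m n / (m < n)%N} -> forall n, (n <= s n)%N.
Proof. by move=> sh; elim=> // n IH; apply: leq_ltn_trans IH (sh _ _ _). Qed.

Lemma frequently_subsequence (P : nat -> Prop) : frequently P ->
  exists2 s : nat -> nat, {homo s : m n / (m < n)%N} & forall n, P (s n).
Proof.
move=> fP; have [nxt nxtP] : {nxt : nat -> nat & forall N, (N <= nxt N)%N /\ P (nxt N)}.
  apply: (@choice _ _ (fun N n => (N <= n)%N /\ P n)) => N.
  by have [n Nn Pn] := fP N; exists n.
pose s := fix s n := if n is m.+1 then nxt (s m).+1 else nxt 0%N.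
exists s; last by case=> [|n] /=; [case: (nxtP 0%N)|case: (nxtP (s n).+1)].
apply: (@homo_ltn _ s (fun m n => (m < n)%N)) => [y x z|n /=]; first exact: ltn_trans.
by case: (nxtP (s n).+1).
Qed.

(** Either some value is taken infinitely often, or the sequence tends to
    infinity and then one of the two parities occurs infinitely often. *)
Lemma nat_seq_subsequence (k : nat -> nat) :
  (exists2 s : nat -> nat, {homo s : m n / (m < n)%N} &
     exists m, forall n, k (s n) = m) \/
  (exists2 s : nat -> nat, {homo s : m n / (m < n)%N} &
     (exists b, forall n, odd (k (s n)) = b) /\
     forall M, \forall n \near \oo, (M <= k (s n))%N).
Proof.
have [[m /frequently_subsequence[s sh sm]]|/forallNP kinf] :=
  pselect (exists m, frequently (fun j => k j = m)).
  by left; exists s => //; exists m.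
right; have {}kinf m : exists N, forall n, (N <= n)%N -> k n <> m.
  have /existsNP[N NP] := kinf m; exists N => n Nn knm; apply: NP.
  by exists n.
have kM M : exists N, forall n, (N <= n)%N -> (M <= k n)%N.
  elim: M => [|M [N NP]]; first by exists 0%N.
  have [N' N'P] := kinf M; exists (maxn N N') => n; rewrite geq_max => /andP[Nn N'n].
  by rewrite ltn_neqAle NP// andbT eq_sym; apply/eqP/N'P.
suff [s sh sb] : exists2 s : nat -> nat, {homo s : m n / (m < n)%N} &
    exists b, forall n, odd (k (s n)) = b.
  exists s => //; split => // M; have [N NP] := kM M; exists N => // n /= Nn.
  by apply: NP; apply: leq_trans Nn (homo_ltn_ge_id sh n).
have [/frequently_subsequence[s sh so]|/existsNP[N NP]] :=
  pselect (frequently (fun n => odd (k n))).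
  by exists s => //; exists true.
have [s sh se] : exists2 s : nat -> nat, {homo s : m n / (m < n)%N} &
    forall n, ~~ odd (k (s n)).
  apply: (@frequently_subsequence (fun n => ~~ odd (k n))) => N'.
  exists (maxn N N'); first exact: leq_maxr.
  by apply/negP => o; apply: NP; exists (maxn N N') => //; exact: leq_maxl.
by exists s => //; exists false => n; exact: negbTE.
Qed.

End Subsequences.

Section FatouSets.
Variable R : realType.
Local Notation C := (R[i]^o).
Implicit Types (z w : C) (h : C -> C) (D V : set C).

(** The two possible limits are indexed by parity so as to cover both escape
    to infinity and attraction by a cycle of period two. *)
Lemma normal_iter_of_cvg h D (q : bool -> option C) : open D ->
  (forall e : R, 0 < e -> \forall n \near \oo,
     forall w, D w -> chordal (Some (iter n h w)) (q (odd n)) < e) ->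
  normal_family D (range (fun n : nat => iter n h)).
Proof.
move=> oD hq u ur; have [k kP] : {k : nat -> nat & forall n, u n = iter (k n) h}.
  apply: (@choice _ _ (fun n m => u n = iter m h)) => n.
  by have [m _ <-] := ur n; exists m.
have [[s sh [m sm]]|[s sh [[b sb] sinf]]] := nat_seq_subsequence k.
  exists s; split=> //; exists (fun w => Some (iter m h w)) => z Dz.
  exists D; first exact: open_nbhs_nbhs.
  by move=> e e0; apply: nearW => n w _ /=; rewrite kP sm chordalxx.
exists s; split=> //; exists (fun _ => q b) => z Dz.
exists D; first exact: open_nbhs_nbhs.
move=> e e0; have [N _ NP] := hq _ e0; near=> n => w Dw /=.
by rewrite kP -(sb n); apply: NP => //=; near: n; exact: sinf.
Unshelve. all: by end_near. Qed.

Lemma Fatou_open h : open (Fatou h).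
Proof.
rewrite openE => z [D [oD Dz] nD]; rewrite /interior nbhsE; exists D => //.
by move=> w Dw; exists D.
Qed.

Definition open_at h z := forall V, nbhs z V -> nbhs (h z) (h @` V).

Lemma open_at_comp h1 h2 z :
  open_at h1 z -> open_at h2 (h1 z) -> open_at (h2 \o h1) z.
Proof.
move=> o1 o2 V /o1 /o2; rewrite /= => nV; suff -> : (h2 \o h1) @` V = h2 @` (h1 @` V) by [].
by rewrite image_comp.
Qed.

Lemma continuous_iter h n : continuous h -> continuous (iter n h).
Proof.
move=> ch; elim: n => [|n IH] z /=; first exact: cvg_id.
by apply: (@continuous_comp _ _ _ (iter n h) h); [exact: IH|exact: ch].
Qed.

Lemma sphere_cvg_unique (u : nat -> option C) p q :
  (forall e : R, 0 < e -> \forall n \near \oo, chordal (u n) p < e) ->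
  (forall e : R, 0 < e -> \forall n \near \oo, chordal (u n) q < e) -> p = q.
Proof.
move=> up uq; apply: chordal_eq => e e0.
have e20 : 0 < e / 2 by rewrite divr_gt0.
have := filterI (up _ e20) (uq _ e20) => -[N _ /(_ N (leqnn N))[up' uq']].
rewrite -(divfK (lt0r_neq0 (ltr0n R 2)) e) mulrC.
by apply: chordal_triangle uq'; rewrite chordal_sym.
Qed.

(** Normality of the iterates near [z] descends to the image of a neighbourhood
    of [z] because [h] is open there: locally uniform limits are read off on
    preimages, and uniqueness of limits makes the reading independent of the
    preimage chosen. *)
Lemma Fatou_forward_open h O z : open O -> O z ->
  (forall w, O w -> open_at h w) -> Fatou h z -> Fatou h (h z).
Proof.
move=> oO Oz hO [D [oD Dz] nD]; set D0 := D `&` O.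
have oD0 : open D0 by exact: openI.
exists (h @` D0).
  split; last by exists z.
  rewrite openE => _ [w [Dw Ow] <-]; rewrite /interior; apply: hO => //.
  by apply: open_nbhs_nbhs; split.
move=> u ur; pose u1 n := u n \o h.
have [s [sh [l ul]]] : exists s, {homo s : m n / (m < n)%N} /\
    exists l, sphere_cvg_locally_uniformly D (u1 \o s) l.
  by apply: nD => n; have [m _ um] := ur n; exists m.+1 => //; rewrite /u1 -um;
     apply/funext => w; rewrite iterSr.
exists s; split=> //.
have ulz w : D w -> forall e : R, 0 < e ->
    \forall n \near \oo, chordal (Some (u (s n) (h w))) (l w) < e.
  move=> Dw e e0; have [V zV /(_ _ e0)] := ul _ Dw.
  by apply: filterS => n; apply; exact: nbhs_singleton zV.
(* The limit at [h w] is read off at an arbitrary preimage in [D0]. *)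
have [l' l'P] : {l' : C -> option C & forall w, D0 w -> l' (h w) = l w}.
  have [pre preP] : {pre : C -> C & forall v, (h @` D0) v ->
      D0 (pre v) /\ h (pre v) = v}.
    apply: (@choice _ _ (fun v w => (h @` D0) v -> D0 w /\ h w = v)) => v.
    by have [[w]|nv] := pselect ((h @` D0) v); [exists w|exists 0].
  exists (l \o pre) => w Dw /=.
  have [[Dp _] hp] := preP (h w) (ex_intro2 _ _ w Dw erefl).
  by apply: sphere_cvg_unique (ulz _ Dp) _; rewrite hp; exact: ulz Dw.1.
exists l' => _ [w [Dw Ow] <-]; have [V wV Vu] := ul _ Dw.
exists (h @` (V `&` D0)).
  by apply: hO => //; apply: filterI => //; apply: open_nbhs_nbhs; split.
move=> e /Vu; apply: filterS => n un _ [v [Vv Dv] <-] /=.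
by rewrite l'P//; exact: un.
Qed.

(** The values of a locally uniform limit near [z] are chordally close to its
    value at [z], which is infinity; orbits returning to a fixed disk from
    points arbitrarily close to [z] are incompatible with that. *)
Lemma not_Fatou_escaping h z (M : R) : continuous h ->
  (forall K, \forall n \near \oo, K < cmod (iter n h z)) ->
  (forall (e : R) (N : nat), 0 < e -> exists n w,
     [/\ (N <= n)%N, cmod (w - z) < e & cmod (iter n h w) <= M]) ->
  ~ Fatou h z.
Proof.
move=> ch hz ret [D [oD Dz] nD].
have [kw kwP] : {kw : nat -> nat * C & forall j, [/\ (j <= (kw j).1)%N,
    cmod ((kw j).2 - z) < j.+1%:R^-1 & cmod (iter (kw j).1 h (kw j).2) <= M]}.
  apply: (@choice _ _ (fun j (p : nat * C) => [/\ (j <= p.1)%N,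
    cmod (p.2 - z) < j.+1%:R^-1 & cmod (iter p.1 h p.2) <= M])) => j.
  have [|n [w [jn wz hw]]] := ret j.+1%:R^-1 j; first by rewrite invr_gt0.
  by exists (n, w).
pose u j := iter (kw j).1 h.
have [s [sh [l ul]]] : exists s, {homo s : m n / (m < n)%N} /\
    exists l, sphere_cvg_locally_uniformly D (u \o s) l.
  by apply: nD => n; exists (kw n).1.
have sge := homo_ltn_ge_id sh.
have [V zV Vu] := ul _ Dz.
have lz : l z = None.
  apply: (@sphere_cvg_unique (fun n => Some (u (s n) z))) => e e0.
    by apply: filterS (Vu _ e0) => n; apply; exact: nbhs_singleton zV.
  have [N _ NP] := hz (2 / e); exists N => // n /= Nn.
  apply: chordal_infty_lt => //; apply: NP => /=.
  by case: (kwP (s n)) => + _ _; apply: leq_trans; apply: leq_trans Nn (sge n).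
(* The factor [8] absorbs three applications of the triangle inequality. *)
pose e0 : R := 2 / Num.sqrt (1 + M ^+ 2) / 8.
have e00 : 0 < e0 by rewrite !divr_gt0// sqrt1D_gt0.
have [J _ JP] := Vu _ e00.
have [d d0 dP] : exists2 d : R, 0 < d &
    forall w, cmod (w - z) < d -> cmod (u (s J) w - u (s J) z) < e0 / 2.
  apply: ((continuous_cmod (u (s J)) z).1 _ (e0 / 2)); last by rewrite divr_gt0.
  exact: continuous_iter.
have [r r0 rV] := (nbhs_cmod _ _).1 zV.
have [n [Jn nd nr]] : exists n, [/\ (J <= n)%N, n.+1%:R^-1 < d & n.+1%:R^-1 < r].
  have [n1 _ n1P] := near_infty_natSinv_lt (PosNum d0).
  have [n2 _ n2P] := near_infty_natSinv_lt (PosNum r0).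
  exists (maxn J (maxn n1 n2)); rewrite leq_maxl; split=> //.
    by apply: n1P => /=; rewrite maxnCA leq_maxl.
  by apply: n2P => /=; rewrite maxnA leq_maxr.
have [_ wz hw] := kwP (s n).
set w := (kw (s n)).2 in wz hw.
have {}wz : cmod (w - z) < n.+1%:R^-1.
  apply: lt_le_trans wz _; rewrite lef_pV2 ?posrE// ler_nat ltnS; exact: sge.
have Vw : V w by apply: rV; exact: lt_trans nr.
have c1 : chordal (Some (u (s n) w)) (Some (u (s J) w)) < 2 * e0.
  apply: (@chordal_triangle _ (l w)); first exact: (JP n Jn).
  by rewrite chordal_sym; exact: (JP J (leqnn _)).
have c2 : chordal (Some (u (s J) w)) (Some (u (s J) z)) < 2 * e0.
  apply: le_lt_trans (chordal_le_cmod _ _) _; rewrite ltr_pM2l//.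
  by apply: lt_le_trans (dP _ (lt_trans wz nd)) _;
     rewrite ler_pdivrMr// ler_peMr ?ltW// ltr1n.
have c3 : chordal (Some (u (s J) z)) None < 2 * (2 * e0).
  rewrite -lz; apply: lt_le_trans (JP J (leqnn _) _ (nbhs_singleton zV)) _.
  by have := e00; lra.
have c4 := chordal_triangle (chordal_triangle c1 c2) c3.
have c5 := chordal_infty_gt hw.
have : 2 / Num.sqrt (1 + M ^+ 2) < 2 * (2 * (2 * e0)) by exact: le_lt_trans c4.
by rewrite /e0; lra.
Qed.

End FatouSets.
(** * Strict differentiability and open maps *)

Section StrictDerivative.
Variable R : realType.
Local Notation C := (R[i]^o).
Implicit Types (z w a b l : C) (f : C -> C).
Local Notation Re := (@complex.Re R).
Local Notation Im := (@complex.Im R).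

Lemma eq0_le_half_pow (x K : R) : 0 <= x -> (forall n, x <= K / 2 ^+ n) -> x = 0.
Proof.
move=> x0 xK; apply/eqP; rewrite eq_le x0 andbT leNgt; apply/negP => {}x0.
have K0 : 0 < K by have := xK 0%N; rewrite expr0 divr1; apply: lt_le_trans.
have [n _ /(_ n (leqnn n))/=] := near_infty_natSinv_lt (PosNum (divr_gt0 x0 K0)).
apply/negP; rewrite -leNgt ler_pdivrMr// mulrC.
apply: le_trans (xK n) _; rewrite ler_pM2l// lef_pV2 ?posrE ?exprn_gt0//.
by rewrite -natrX ler_nat; exact: ltn_expl.
Qed.

Lemma real_limit_of_halving (x : nat -> R) c :
  (forall n, `|x n.+1 - x n| <= c / 2 ^+ n) ->
  exists y, forall n, `|y - x n| <= 2 * c / 2 ^+ n.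
Proof.
move=> xc; pose e n : R := 2 * c / 2 ^+ n.
have eS n : e n = e n.+1 + c / 2 ^+ n.
  by rewrite /e exprS; field; rewrite expf_neq0.
have nd : {homo (fun n => x n - e n) : m n / (m <= n)%N >-> m <= n}.
  apply: homo_leq => //; first exact: le_trans.
  by move=> n; have := xc n; rewrite ler_norml (eS n) => /andP[]; lra.
have ni : {homo (fun n => x n + e n) : m n / (m <= n)%N >-> n <= m}.
  apply: homo_leq => //; first by move=> ? ? ? ? /le_trans; exact.
  by move=> n; have := xc n; rewrite ler_norml (eS n) => /andP[]; lra.
have e0 n : 0 <= e n.
  have := le_trans (normr_ge0 _) (xc n); rewrite /e -mulrA; exact: mulr_ge0.
have le_mn m n : x m - e m <= x n + e n.
  apply: le_trans (nd _ _ (leq_maxl m n)) _.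
  apply: le_trans _ (ni _ _ (leq_maxr m n)).
  by have := e0 (maxn m n); lra.
(* The intervals of radius [e n] around [x n] are nested; the supremum of their
   left ends lies in all of them. *)
pose E := range (fun n => x n - e n).
have E0 : E !=set0 by exists (x 0%N - e 0%N); exists 0%N.
exists (sup E) => n; rewrite -/(e n) ler_distl; apply/andP; split.
  apply: ub_le_sup; last by exists n.
  by exists (x 0%N + e 0%N) => _ [m _ <-]; exact: le_mn.
by apply: ge_sup => // _ [m _ <-]; exact: le_mn.
Qed.

Lemma complex_limit_of_halving (x : nat -> C) c :
  (forall n, cmod (x n.+1 - x n) <= c / 2 ^+ n) ->
  exists y, forall n, cmod (y - x n) <= 4 * c / 2 ^+ n.
Proof.
move=> xc.
have ReB z w : Re (z - w) = Re z - Re w by case: z w => ? ? [].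
have ImB z w : Im (z - w) = Im z - Im w by case: z w => ? ? [].
have [|p pP] := @real_limit_of_halving (Re \o x) c.
  by move=> n; rewrite /= -ReB; exact: le_trans (abs_Re_le _) (xc n).
have [|q qP] := @real_limit_of_halving (Im \o x) c.
  by move=> n; rewrite /= -ImB; exact: le_trans (abs_Im_le _) (xc n).
exists (p +i* q) => n; apply: le_trans (cmod_le_ReIm _) _.
by rewrite ReB ImB /=; have := pP n; have := qP n; rewrite /=; lra.
Qed.

Definition strict_deriv f z l := forall e : R, 0 < e -> exists2 d : R, 0 < d &
  forall a b, cmod (a - z) < d -> cmod (b - z) < d ->
    cmod (f a - f b - l * (a - b)) <= e * cmod (a - b).

(** Strict differentiability bounds the increments between any two points near
    [z]; with one of them equal to [z], it is differentiability at [z]. *)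
Lemma derivable_strict f z l : strict_deriv f z l -> derivable f z 1.
Proof.
move=> fl; apply/cvg_ex; exists l => V /nbhs_cmod[e e0 eV].
have [d d0 dP] := fl (e / 2) (divr_gt0 e0 (ltr0n _ 2)).
apply/nbhs_cmod; exists d => // h; rewrite subr0 => hd h0; apply: eV.
have -> : h^-1 *: ((f \o shift z) (h *: (1 : C)) - f z) - l =
    h^-1 * (f (h + z) - f z - l * (h + z - z)).
  rewrite /= /shift /= [h *: 1]mulr1 addrK -[h^-1 *: _]/(h^-1 * _).
  by field.
rewrite cmodM; have hp : 0 < cmod h by rewrite cmod_gt0.
have hV : cmod h^-1 * cmod h = 1.
  by rewrite -cmodM mulVf// /cmod normr1.
rewrite -(ltr_pM2r hp) mulrAC hV mul1r.
apply: le_lt_trans (dP _ _ _ _) _; first by rewrite addrK.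
  by rewrite subrr cmod0.
by rewrite addrK ltr_pM2r// ltr_pdivrMr// ltr_pMr// ltr1n.
Qed.

Lemma strict_deriv_continuous f z l : strict_deriv f z l -> {for z, continuous f}.
Proof.
move=> fl; apply/continuous_cmod => e e0; have [d d0 dP] := fl 1 ltr01.
have K0 : 0 < 1 + cmod l by rewrite ltr_pwDl// cmod_ge0.
exists (Num.min d (e / (1 + cmod l))); first by rewrite lt_min d0 divr_gt0.
move=> w; rewrite lt_min => /andP[wd we].
have := dP w z wd; rewrite subrr cmod0 => /(_ d0); rewrite mul1r => H.
have -> : f w - f z = (f w - f z - l * (w - z)) + l * (w - z) by rewrite subrK.
apply: le_lt_trans (cmodD _ _) _; rewrite cmodM.
apply: le_lt_trans (lerD H (lexx _)) _.
by move: we; rewrite ltr_pdivlMr//; lra.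
Qed.

(** Newton iteration with the derivative frozen at [z] is a contraction near
    [z], and it solves [f a = w] for every [w] close to [f z]. *)
Lemma open_at_strict f z l : l != 0 -> strict_deriv f z l -> open_at f z.
Proof.
move=> l0 fl V /nbhs_cmod[r r0 rV]; have lp : 0 < cmod l by rewrite cmod_gt0.
have [d d0 dP] := fl (cmod l / 2) (divr_gt0 lp (ltr0n _ 2)).
pose rho := Num.min r d; have rho0 : 0 < rho by rewrite lt_min r0.
apply/nbhs_cmod; exists (cmod l * (rho / 8)); first by rewrite !mulr_gt0// invr_gt0.
move=> w wfz; pose T a : C := a + l^-1 * (w - f a); pose x n := iter n T z.
have lVl : cmod l^-1 * cmod l = 1 by rewrite -cmodM mulVf// /cmod normr1.
have lV0 : 0 < cmod l^-1 by rewrite cmod_gt0 invr_eq0.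
have TT a b : cmod (a - z) < d -> cmod (b - z) < d ->
    cmod (T a - T b) <= cmod (a - b) / 2.
  move=> ad bd.
  have -> : T a - T b = - (l^-1 * (f a - f b - l * (a - b))) by rewrite /T; field.
  rewrite cmodN cmodM -(ler_pM2l lp) mulrA [cmod l * _]mulrC lVl mul1r.
  by apply: le_trans (dP a b ad bd) _; lra.
pose c := cmod (T z - z).
have c0 : 0 <= c by exact: cmod_ge0.
have cE : c < rho / 8.
  rewrite /c [T z]addrC addrK cmodM -(ltr_pM2l lp) mulrA [cmod l * _]mulrC lVl mul1r.
  exact: wfz.
have xP n : cmod (x n.+1 - x n) <= c / 2 ^+ n /\ cmod (x n - z) <= 2 * c - 2 * c / 2 ^+ n.
  elim: n => [|n [IH1 IH2]].
    by rewrite /x /= subrr cmod0 expr0 !divr1; split=> //; rewrite subrr.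
  have pw : 2 * c / 2 ^+ n.+1 = c / 2 ^+ n by rewrite exprS; field; rewrite expf_neq0.
  have p0 : 0 <= c / 2 ^+ n by rewrite divr_ge0// exprn_ge0.
  have IH3 : cmod (x n.+1 - z) <= 2 * c - 2 * c / 2 ^+ n.+1.
    apply: le_trans (cmod_dist_triangle (x n) _ _) _.
    by rewrite pw; move: IH1 IH2; rewrite -mulrA; lra.
  have rd : rho <= d by rewrite ge_min lexx orbT.
  split=> //; apply: le_trans (TT _ _ _ _) _.
  - by apply: le_lt_trans IH3 _; rewrite pw; lra.
  - by apply: le_lt_trans IH2 _; rewrite -mulrA; lra.
  - have -> : c / 2 ^+ n.+1 = c / 2 ^+ n / 2 by rewrite exprS; field; rewrite expf_neq0.
    by rewrite ler_pM2r.
have [a aP] := complex_limit_of_halving (fun n => (xP n).1).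
have az : cmod (a - z) < rho.
  by apply: le_lt_trans (aP 0%N) _; rewrite expr0 divr1; lra.
have [rr rd] : rho <= r /\ rho <= d by rewrite !ge_min !lexx orbT.
exists a; first by apply: rV; exact: lt_le_trans rr.
apply/eqP; rewrite -subr_eq0 -cmod_eq0; apply/eqP.
apply: (@eq0_le_half_pow _ (8 * (cmod l * c))) => [|n]; first exact: cmod_ge0.
have -> : f a - w = (f a - f (x n) - l * (a - x n)) + l * (a - x n) - l * (x n.+1 - x n).
  by rewrite /x /= -/(x n) /T; field.
apply: le_trans (cmodD _ _) _; rewrite cmodN.
apply: le_trans (lerD (cmodD _ _) (lexx _)) _; rewrite !cmodM.
have xd : cmod (x n - z) < d.
  apply: le_lt_trans (xP n).2 _; apply: le_lt_trans _ (lt_le_trans _ rd).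
  have : 0 <= c / 2 ^+ n by rewrite divr_ge0// exprn_ge0.
  by rewrite -mulrA; instantiate (1 := 2 * c); lra.
  by lra.
have := dP a (x n) (lt_le_trans az rd) xd.
have := ler_wpM2l (ltW lp) (aP n); have := ler_wpM2l (ltW lp) (xP n).1.
have : 0 <= cmod l * (c / 2 ^+ n).
  by rewrite mulr_ge0 ?(ltW lp)// divr_ge0// exprn_ge0.
by rewrite -!mulrA; lra.
Qed.

End StrictDerivative.
(** * Hyperbolic functions and the complex sine *)

Section Hyperbolic.
Variable R : realType.
Implicit Types x y : R.

Definition ch x : R := (expR x + expR (- x)) / 2.
Definition sh x : R := (expR x - expR (- x)) / 2.

Lemma chN x : ch (- x) = ch x.
Proof. by rewrite /ch opprK addrC. Qed.

Lemma shN x : sh (- x) = - sh x.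
Proof. by rewrite /sh opprK -mulNr opprB. Qed.

Lemma ch0 : ch 0 = 1.
Proof. by rewrite /ch oppr0 expR0; field. Qed.

Lemma sh0 : sh 0 = 0.
Proof. by rewrite /sh oppr0 subrr mul0r. Qed.

Lemma chD x y : ch (x + y) = ch x * ch y + sh x * sh y.
Proof. by rewrite /ch /sh opprD !expRD; field. Qed.

Lemma shD x y : sh (x + y) = sh x * ch y + ch x * sh y.
Proof. by rewrite /ch /sh opprD !expRD; field. Qed.

Lemma ch2Bsh2 x : ch x ^+ 2 - sh x ^+ 2 = 1.
Proof. by rewrite -[RHS](expRxMexpNx_1 x) /ch /sh; field. Qed.

Lemma ch_gt0 x : 0 < ch x.
Proof. by rewrite /ch divr_gt0// addr_gt0// expR_gt0. Qed.

Lemma ch_ge1 x : 1 <= ch x.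
Proof.
rewrite -(@ler_pXn2r _ 2) ?nnegrE ?(ltW (ch_gt0 _))// expr1n.
by have := ch2Bsh2 x; have := sqr_ge0 (sh x); lra.
Qed.

Lemma sh_eq0 x : sh x = 0 -> x = 0.
Proof.
rewrite /sh => /eqP; rewrite mulf_eq0 invr_eq0 (pnatr_eq0 _ 2) orbF subr_eq0.
by move=> /eqP /expR_inj; lra.
Qed.

Lemma continuous_ch : continuous ch.
Proof.
move=> x; apply: cvgMl; apply: cvgD; first exact: continuous_expR.
by apply: (@continuous_comp _ _ _ -%R expR); [exact: opp_continuous|exact: continuous_expR].
Qed.

Lemma continuous_sh : continuous sh.
Proof.
move=> x; apply: cvgMl; apply: cvgB; first exact: continuous_expR.
by apply: (@continuous_comp _ _ _ -%R expR); [exact: opp_continuous|exact: continuous_expR].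
Qed.

Lemma tangent_id_of_derive (f : R -> R) : f 0 = 0 -> is_derive (0 : R) (1 : R) f 1 ->
  forall e : R, 0 < e -> exists2 d : R, 0 < d & forall x, `|x| < d -> `|f x - x| <= e * `|x|.
Proof.
move=> f0 [fd fv] e e0.
have : (fun h => h^-1 *: ((f \o shift 0) (h *: (1 : R)) - f 0)) @ 0^' --> ('D_1 f 0 : R).
  exact: fd.
rewrite fv => /cvgrPdist_le /(_ _ e0) /nbhs_ballP[d /= d0 dP]; exists d => // x xd.
have [->|x0] := eqVneq x 0; first by rewrite f0 subrr normr0 mulr0.
have := dP x; rewrite /ball /= sub0r normrN => /(_ xd x0).
rewrite /shift /= [x *: 1]mulr1 addr0 f0 subr0 -(ler_pM2r (_ : 0 < `|x|)) ?normr_gt0//.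
by rewrite -normrM mulrBl mul1r [x^-1 *: _]mulrC divfK// distrC.
Qed.

Global Instance is_derive_sh x : is_derive x 1 sh (ch x).
Proof.
rewrite /sh /ch; apply: is_derive_eq.
by rewrite /GRing.scale /=; ring.
Qed.

End Hyperbolic.
Section ComplexSine.
Variable R : realType.
Local Notation C := (R[i]^o).
Implicit Types (z w a b : C).
Local Notation Re := (@complex.Re R).
Local Notation Im := (@complex.Im R).

Definition csin z : C :=
  (sin (Re z) * ch (Im z)) +i* (cos (Re z) * sh (Im z)).

Definition ccos z : C :=
  (cos (Re z) * ch (Im z)) -i* (sin (Re z) * sh (Im z)).

Lemma csinD z w : csin (z + w) = csin z * ccos w + ccos z * csin w.
Proof.
by case: z w => [a b] [c d]; apply: ReIm_eq; rewrite /= ?(sinD, cosD, chD, shD); ring.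
Qed.

Lemma csinN z : csin (- z) = - csin z.
Proof.
by case: z => [a b]; apply: ReIm_eq; rewrite /= ?(sinN, cosN, chN, shN); ring.
Qed.

Lemma ccosN z : ccos (- z) = ccos z.
Proof.
by case: z => [a b]; apply: ReIm_eq; rewrite /= ?(sinN, cosN, chN, shN); ring.
Qed.

(** This factorization exhibits [csin a - csin b] as a perturbation of
    [ccos z * (a - b)] when [a] and [b] are both close to [z]. *)
Lemma csinB_half a b :
  csin a - csin b = 2 * (ccos ((a + b) / 2) * csin ((a - b) / 2)).
Proof.
have -> : csin a = csin ((a + b) / 2 + (a - b) / 2) by congr csin; field.
have -> : csin b = csin ((a + b) / 2 - (a - b) / 2) by congr csin; field.
by rewrite !csinD ccosN csinN; ring.
Qed.

Lemma continuous_Im : continuous (Im : C -> R).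
Proof.
move=> z V /nbhs_ballP[e /= e0 eV]; apply/nbhs_cmod; exists e => // w wz.
apply: eV; rewrite /ball /= distrC; apply: le_lt_trans wz.
by have := abs_Im_le (w - z); case: (w) (z) => [? ?] [].
Qed.

Lemma continuous_of_ReIm (f : C -> C) :
  continuous (Re \o f) -> continuous (Im \o f) -> continuous f.
Proof.
move=> cRe cIm z; apply/continuous_cmod => e e0.
have e20 : 0 < e / 2 by rewrite divr_gt0.
have /cvgrPdist_lt/(_ _ e20)/nbhs_cmod[d1 d10 P1] := (cRe z).
have /cvgrPdist_lt/(_ _ e20)/nbhs_cmod[d2 d20 P2] := (cIm z).
exists (Num.min d1 d2) => [|w]; first by rewrite lt_min d10.
rewrite lt_min => /andP[/P1 /= H1 /P2 /= H2].
apply: le_lt_trans (cmod_le_ReIm _) _.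
have -> : Re (f w - f z) = Re (f w) - Re (f z) by case: (f w) (f z) => ? ? [].
have -> : Im (f w - f z) = Im (f w) - Im (f z) by case: (f w) (f z) => ? ? [].
by move: H1 H2; rewrite 2![`|_ - _ (f w)|]distrC; lra.
Qed.

Lemma continuous_mul_ReIm (f g : R -> R) : continuous f -> continuous g ->
  continuous (fun z : C => f (Re z) * g (Im z)).
Proof.
move=> cf cg z.
have cRe : {for z, continuous (f \o Re : C -> R)}.
  exact: (@continuous_comp C R R Re f z (@continuous_Re R z) (cf (Re z))).
have cIm : {for z, continuous (g \o Im : C -> R)}.
  exact: (@continuous_comp C R R Im g z (@continuous_Im z) (cg (Im z))).
exact: (continuousM cRe cIm).
Qed.

Lemma continuous_ccos : continuous ccos.
Proof.
apply: continuous_of_ReIm.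
  exact: continuous_mul_ReIm (@continuous_cos R) (@continuous_ch R).
move=> z; have c := @continuous_mul_ReIm _ _ (@continuous_sin R) (@continuous_sh R) z.
exact: (continuousN c).
Qed.

Lemma csin_tangent (e : R) : 0 < e -> exists2 d : R, 0 < d &
  forall z, cmod z < d -> cmod (csin z - z) <= e * cmod z.
Proof.
move=> e0; pose k := Num.min 1 (e / 5).
have k0 : 0 < k by rewrite lt_min ltr01 divr_gt0.
have [k1 ke] : k <= 1 /\ k <= e / 5 by rewrite !ge_min !lexx orbT.
have is_derive_sin0 : is_derive (0 : R) (1 : R) sin 1.
  by have := is_derive_sin (0 : R); rewrite cos0.
have is_derive_sh0 : is_derive (0 : R) (1 : R) (@sh R) 1.
  by have := is_derive_sh (0 : R); rewrite ch0.
have [d1 d10 P1] := tangent_id_of_derive (sin0 R) is_derive_sin0 k0.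
have [d2 d20 P2] := tangent_id_of_derive (sh0 R) is_derive_sh0 k0.
have /cvgrPdist_lt/(_ _ k0)/nbhs_ballP[d3 /= d30 P3] := (@continuous_ch R 0).
have /cvgrPdist_lt/(_ _ k0)/nbhs_ballP[d4 /= d40 P4] := (@continuous_cos R 0).
exists (Num.min (Num.min d1 d2) (Num.min d3 d4)) => [|z]; first by rewrite !lt_min d10 d20 d30.
rewrite !lt_min => /andP[/andP[z1 z2] /andP[z3 z4]].
have Rez := abs_Re_le z; have Imz := abs_Im_le z.
apply: le_trans (cmod_le_ReIm _) _.
have {z1 P1}sinP := P1 (Re z) (le_lt_trans Rez z1).
have {z2 P2}shP := P2 (Im z) (le_lt_trans Imz z2).
have chP : `|ch (Im z) - 1| <= k.
  rewrite distrC -(ch0 R); apply/ltW/P3; rewrite /ball /= sub0r normrN.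
  exact: le_lt_trans z3.
have cosP : `|cos (Re z) - 1| <= k.
  rewrite distrC -(cos0 R); apply/ltW/P4; rewrite /ball /= sub0r normrN.
  exact: le_lt_trans z4.
have -> : Re (csin z - z) =
    (sin (Re z) - Re z) * (1 + (ch (Im z) - 1)) + Re z * (ch (Im z) - 1).
  by case: z {Rez Imz z3 z4 sinP shP chP cosP} => a b /=; ring.
have -> : Im (csin z - z) = cos (Re z) * (sh (Im z) - Im z) + Im z * (cos (Re z) - 1).
  by case: z {Rez Imz z3 z4 sinP shP chP cosP} => a b /=; ring.
have c0 := cmod_ge0 z.
have M1 : `|(sin (Re z) - Re z) * (1 + (ch (Im z) - 1))| <= (k * cmod z) * 2.
  rewrite normrM ler_pM//.
    by apply: le_trans sinP _; rewrite ler_pM2l.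
  by apply: le_trans (ler_normD _ _) _; rewrite normr1; move: chP k1; lra.
have M2 : `|Re z * (ch (Im z) - 1)| <= cmod z * k by rewrite normrM ler_pM.
have M3 : `|cos (Re z) * (sh (Im z) - Im z)| <= 1 * (k * cmod z).
  rewrite normrM ler_pM ?cos_max//.
  by apply: le_trans shP _; rewrite ler_pM2l.
have M4 : `|Im z * (cos (Re z) - 1)| <= cmod z * k by rewrite normrM ler_pM.
apply: le_trans (lerD (ler_normD _ _) (ler_normD _ _)) _.
apply: le_trans (lerD (lerD M1 M2) (lerD M3 M4)) _.
by have := ler_wpM2r c0 ke; lra.
Qed.

Lemma csin_strict_deriv z : strict_deriv csin z (ccos z).
Proof.
move=> e e0; have L0 := cmod_ge0 (ccos z).
have Le0 : 0 < 2 * (cmod (ccos z) + e) by rewrite mulr_gt0// ltr_wpDl.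
have e20 : 0 < e / 2 by rewrite divr_gt0.
have [d1 d10 P1] := (continuous_cmod _ _).1 (@continuous_ccos z) _ e20.
have [d2 d20 P2] := csin_tangent (divr_gt0 e0 Le0).
exists (Num.min d1 d2) => [|a b]; first by rewrite lt_min d10.
rewrite !lt_min => /andP[a1 a2] /andP[b1 b2].
(* [m] is close to [z] and [d] is close to zero. *)
pose m := (a + b) / 2; pose d := (a - b) / 2.
have half (x y : C) : cmod (x / 2) = cmod x / 2.
  have := cmodM x 2^-1; rewrite (_ : cmod 2^-1 = 2^-1)//.
  have -> : (2^-1 : C) = (2^-1 : R)%:C by rewrite fmorphV rmorphMn.
  by rewrite cmod_real ger0_norm// invr_ge0.
have mz : cmod (m - z) < d1.
  have -> : m - z = (a - z + (b - z)) / 2 by rewrite /m; field.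
  by rewrite half//; have := cmodD (a - z) (b - z); lra.
have dd : cmod d < d2.
  have -> : d = (a - z - (b - z)) / 2 by rewrite /d; field.
  by rewrite half//; have := cmodD (a - z) (- (b - z)); rewrite cmodN; lra.
have -> : csin a - csin b - ccos z * (a - b) =
    ((ccos m - ccos z) * d + ccos m * (csin d - d)) +
    ((ccos m - ccos z) * d + ccos m * (csin d - d)).
  by rewrite csinB_half -/m -/d (_ : a - b = d + d); [ring|rewrite /d; field].
have -> : cmod (a - b) = 2 * cmod d by rewrite /d half//; field.
have cm : cmod (ccos m) <= cmod (ccos z) + e.
  rewrite -(subrK (ccos z) (ccos m)); apply: le_trans (cmodD _ _) _.
  by have := P1 m mz; lra.
have T1 : cmod ((ccos m - ccos z) * d) <= e / 2 * cmod d.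
  by rewrite cmodM ler_wpM2r ?cmod_ge0// ltW// P1.
have T2 : cmod (ccos m * (csin d - d)) <= e / 2 * cmod d.
  rewrite cmodM; apply: le_trans (ler_pM (cmod_ge0 _) (cmod_ge0 _) cm (P2 d dd)) _.
  by rewrite mulrA ler_wpM2r ?cmod_ge0// le_eqVlt; apply/orP; left; apply/eqP; field;
     rewrite lt0r_neq0// ltr_wpDl.
have T := le_trans (cmodD _ _) (lerD T1 T2).
by apply: le_trans (cmodD _ _) _; move: T; lra.
Qed.

End ComplexSine.
(** * The maps built from [z + sin z] *)

Section Maps.
Variable R : realType.
Local Notation C := (R[i]^o).
Implicit Types (z w a b : C) (p c : R) (h : C -> C).
Local Notation Re := (@complex.Re R).
Local Notation Im := (@complex.Im R).

Definition sine_drift z : C := z + csin z.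

Definition reflected_drift c z : C := c%:C - sine_drift z.

Definition shifted_drift2 c z : C := sine_drift (sine_drift z) + c%:C.

Lemma sine_driftN z : sine_drift (- z) = - sine_drift z.
Proof. by rewrite /sine_drift csinN opprD. Qed.

Lemma sine_drift2pi z :
  sine_drift (z + (pi *+ 2)%:C) = sine_drift z + (pi *+ 2)%:C.
Proof.
rewrite /sine_drift addrAC; congr (_ + _ + _).
by apply: ReIm_eq; case: z => a b /=; rewrite ?(sinD2pi, cosD2pi) addr0.
Qed.

Lemma reflected_comp0 c :
  reflected_drift c \o reflected_drift 0 = shifted_drift2 c.
Proof.
apply/funext => z; rewrite /shifted_drift2 /= /reflected_drift sub0r.
by rewrite sine_driftN opprK addrC.
Qed.

Lemma reflected_0comp :
  reflected_drift 0 \o reflected_drift (pi *+ 2) = shifted_drift2 (- (pi *+ 2)).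
Proof.
apply/funext => z; rewrite /shifted_drift2 /= /reflected_drift sub0r.
rewrite -[_ - sine_drift z]opprB sine_driftN opprK.
apply: (addIr (pi *+ 2)%:C); rewrite -sine_drift2pi subrK.
by rewrite rmorphN /= subrK.
Qed.

Lemma sine_drift_strict_deriv z : strict_deriv sine_drift z (1 + ccos z).
Proof.
move=> e e0; have [d d0 dP] := @csin_strict_deriv R z e e0.
exists d => // a b ad bd; apply: le_trans (dP a b ad bd).
by rewrite le_eqVlt; apply/orP; left; apply/eqP; congr cmod; rewrite /sine_drift; ring.
Qed.

Lemma reflected_drift_strict_deriv c z :
  strict_deriv (reflected_drift c) z (- (1 + ccos z)).
Proof.
move=> e e0; have [d d0 dP] := @sine_drift_strict_deriv z e e0.
exists d => // a b ad bd; apply: le_trans (dP a b ad bd).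
by rewrite le_eqVlt; apply/orP; left; apply/eqP; rewrite -cmodN; congr cmod;
  rewrite /reflected_drift; ring.
Qed.

Lemma translation_strict_deriv c z : strict_deriv (fun w : C => w + c%:C) z 1.
Proof.
move=> e e0; exists 1 => // a b _ _.
have -> : a + c%:C - (b + c%:C) - 1 * (a - b) = 0 by ring.
by rewrite cmod0 mulr_ge0 ?cmod_ge0// ltW.
Qed.

Lemma reflected_drift_entire c : entire (reflected_drift c).
Proof. by move=> z; exact: derivable_strict (@reflected_drift_strict_deriv c z). Qed.

Lemma continuous_sine_drift : continuous sine_drift.
Proof. by move=> z; exact: strict_deriv_continuous (@sine_drift_strict_deriv z). Qed.

Lemma continuous_reflected_drift c : continuous (reflected_drift c).
Proof.
by move=> z; exact: strict_deriv_continuous (@reflected_drift_strict_deriv c z).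
Qed.

Lemma continuous_shifted_drift2 c : continuous (shifted_drift2 c).
Proof.
move=> z; have c1 := @continuous_comp C C C sine_drift sine_drift z
  (@continuous_sine_drift z) (@continuous_sine_drift (sine_drift z)).
exact: (@continuous_comp C C C (sine_drift \o sine_drift) (fun w => w + c%:C) z c1
  (strict_deriv_continuous (@translation_strict_deriv c _))).
Qed.

(** The odd multiples of [pi]: they are at once the critical points of
    [sine_drift] and super-attracting fixed points of it. *)
Definition odd_pi p := cos p = -1.

Lemma odd_pi_sin p : odd_pi p -> sin p = 0.
Proof. by move=> pp; apply: cos1sin0; rewrite pp normrN1. Qed.

Lemma odd_piN p : odd_pi p -> odd_pi (- p).
Proof. by rewrite /odd_pi cosN. Qed.

Lemma odd_piD2pi p : odd_pi p -> odd_pi (p + pi *+ 2).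
Proof. by rewrite /odd_pi cosD2pi. Qed.

Lemma odd_piB2pi p : odd_pi p -> odd_pi (p - pi *+ 2).
Proof. by rewrite /odd_pi -[in X in X -> _](subrK (pi *+ 2) p) cosD2pi. Qed.

(** If [1 + cos z = 0] with [z = a + i b], then [sin a * sh b = 0]; when
    [sin a = 0], the real part [cos a * ch b = -1] forces [ch b = 1], hence
    [sh b = 0] and [b = 0] in every case. *)
Lemma ccos_eqN1 z : 1 + ccos z = 0 -> exists2 p, odd_pi p & z = p%:C.
Proof.
case: z => a b /eqP; rewrite eq_complex /= sub0r oppr_eq0 => /andP[/eqP c1 /eqP s0].
suff b0 : b = 0.
  exists a; last by rewrite b0.
  by move: c1; rewrite b0 ch0 mulr1 /odd_pi; lra.
have [//|/eqP shb] := pselect (sh b = 0); first exact: sh_eq0.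
have /sin0cos1 ca : sin a = 0.
  by apply/eqP; move: s0 => /eqP; rewrite mulf_eq0 (negbTE shb) orbF.
have chb : ch b = 1.
  have /(congr1 Num.norm) : cos a * ch b = -1 by lra.
  by rewrite normrM ca normrN1 mul1r ger0_norm// ltW// ch_gt0.
exfalso; move/negP: shb; apply; rewrite -sqrf_eq0.
by have := ch2Bsh2 b; rewrite chb expr1n => /eqP;
  rewrite subr_eq addrC -subr_eq subrr eq_sym.
Qed.

(** Near [p] the map is [w - sin w] in the coordinate [w = z - p], whose linear
    part vanishes. *)
Lemma sine_drift_near_odd_pi p z : odd_pi p ->
  sine_drift z - p%:C = z - p%:C - csin (z - p%:C).
Proof.
move=> pp; rewrite /sine_drift.
have -> : csin z = csin (z - p%:C) * ccos p%:C + ccos (z - p%:C) * csin p%:C.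
  by rewrite -csinD subrK.
have -> : ccos p%:C = -1.
  by apply: ReIm_eq; rewrite /= ?ch0 ?sh0 ?pp ?mulr1 ?mulr0.
have -> : csin p%:C = 0.
  by apply: ReIm_eq; rewrite /= ?ch0 ?sh0 ?(odd_pi_sin pp) ?mul0r ?mulr0.
by ring.
Qed.

Lemma sine_drift_odd_pi p : odd_pi p -> sine_drift p%:C = p%:C.
Proof.
move=> pp; apply/eqP; rewrite -subr_eq0 sine_drift_near_odd_pi// subrr sub0r oppr_eq0.
by apply/eqP/ReIm_eq; rewrite /= ?sin0 ?sh0 ?mul0r ?mulr0.
Qed.

Lemma sine_drift_contracts : exists2 r : R, 0 < r & forall p z, odd_pi p ->
  cmod (z - p%:C) < r -> cmod (sine_drift z - p%:C) <= cmod (z - p%:C) / 2.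
Proof.
have [r r0 rP] := @csin_tangent R 2^-1 (ltac:(by rewrite invr_gt0)).
exists r => // p z pp zp; rewrite sine_drift_near_odd_pi// -cmodN opprB mulrC.
exact: rP.
Qed.

(** Contraction towards the orbit of [p], uniformly in the odd multiples of
    pi; [s] is the induced action on them. *)
Definition contracts_odd_pi h (s : R -> R) (r : R) := forall p, odd_pi p ->
  [/\ odd_pi (s p), h p%:C = (s p)%:C & forall z, cmod (z - p%:C) < r ->
       cmod (h z - (s p)%:C) <= cmod (z - p%:C) / 2].

Lemma contracts_odd_pi_iter h s r p n z : contracts_odd_pi h s r -> odd_pi p ->
  cmod (z - p%:C) < r ->
  [/\ odd_pi (iter n s p), iter n h p%:C = (iter n s p)%:C &
      cmod (iter n h z - (iter n s p)%:C) <= cmod (z - p%:C) / 2 ^+ n].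
Proof.
move=> hs pp zr; elim: n => [|n [IH1 IH2 IH3]]; first by rewrite /= expr0 divr1.
have [H1 H2 H3] := hs _ IH1; rewrite !iterS; split=> //; first by rewrite IH2.
have le1 : cmod (z - p%:C) / 2 ^+ n <= cmod (z - p%:C).
  by rewrite ler_piMr ?cmod_ge0// invf_le1 ?exprn_gt0// exprn_ege1// ler1n.
apply: le_trans (H3 _ (le_lt_trans (le_trans IH3 le1) zr)) _.
by rewrite exprSr invfM mulrA ler_pM2r.
Qed.

(** The iterates approach the constants [p] and [s p] alternately. *)
Lemma Fatou_cycle h s (r : R) p : 0 < r -> contracts_odd_pi h s r -> odd_pi p ->
  s (s p) = p -> cball p%:C r `<=` Fatou h.
Proof.
move=> r0 hs pp ssp z zp; exists (cball p%:C r); first by split => //; exact: cball_open.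
apply: (@normal_iter_of_cvg _ h _ (fun b : bool => Some (if b then s p else p)%:C)).
  exact: cball_open.
have itE n : iter n s p = if odd n then s p else p.
  by elim: n => //= n ->; case: (odd n).
move=> e e0.
have [N _ NP] := near_infty_natSinv_lt (PosNum (divr_gt0 e0 (mulr_gt0 (ltr0n R 2) r0))).
exists N => // n /= Nn w wp; apply: le_lt_trans (chordal_le_cmod _ _) _.
have [_ _] := @contracts_odd_pi_iter h s r p n w hs pp wp.
rewrite itE -(@ler_pM2l _ 2)// => /le_lt_trans; apply.
have := NP n Nn; rewrite /= ltr_pdivlMr ?mulr_gt0// => H.
have H1 : cmod (w - p%:C) / 2 ^+ n <= r * n.+1%:R^-1.
  apply: ler_pM; rewrite ?cmod_ge0 ?invr_ge0 ?exprn_ge0 ?(ltW wp)//.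
  by rewrite lef_pV2 ?posrE ?exprn_gt0// -natrX ler_nat; exact: ltn_expl.
by move: H H1; move: (n.+1%:R^-1) (_ / 2 ^+ n) => y x; lra.
Qed.

(** The images of the disk shrink around an orbit tending to infinity. *)
Lemma Fatou_escaping h s (r : R) p : 0 < r -> contracts_odd_pi h s r -> odd_pi p ->
  (forall K, \forall n \near \oo, K < `|iter n s p|) -> cball p%:C r `<=` Fatou h.
Proof.
move=> r0 hs pp esc z zp; exists (cball p%:C r); first by split => //; exact: cball_open.
apply: (@normal_iter_of_cvg _ h _ (fun _ : bool => None)); first exact: cball_open.
move=> e e0; have [N _ NP] := esc (2 / e + r).
exists N => // n /= Nn w wp; apply: chordal_infty_lt => //.
have [_ _] := @contracts_odd_pi_iter h s r p n w hs pp wp.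
have wr : cmod (w - p%:C) / 2 ^+ n <= r.
  apply: le_trans _ (ltW wp).
  by rewrite ler_piMr ?cmod_ge0// invf_le1 ?exprn_gt0// exprn_ege1// ler1n.
move=> /le_trans /(_ wr) H.
have := NP n Nn; rewrite /= -cmod_real.
have := cmodD ((iter n s p)%:C - iter n h w) (iter n h w).
by rewrite subrK cmod_distC; lra.
Qed.

Lemma reflected_contracts (r : R) c :
  (forall p z, odd_pi p -> cmod (z - p%:C) < r ->
     cmod (sine_drift z - p%:C) <= cmod (z - p%:C) / 2) ->
  (forall p, odd_pi p -> odd_pi (c - p)) ->
  contracts_odd_pi (reflected_drift c) (fun p => c - p) r.
Proof.
move=> Fr cp p pp; split; first exact: cp.
  by rewrite /reflected_drift sine_drift_odd_pi// rmorphB.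
move=> z zp; rewrite /reflected_drift rmorphB /= -cmodN.
have -> : - (c%:C - sine_drift z - (c%:C - p%:C)) = sine_drift z - p%:C by ring.
exact: Fr.
Qed.

Lemma shifted_contracts (r : R) c :
  (forall p z, odd_pi p -> cmod (z - p%:C) < r ->
     cmod (sine_drift z - p%:C) <= cmod (z - p%:C) / 2) ->
  (forall p, odd_pi p -> odd_pi (p + c)) ->
  contracts_odd_pi (shifted_drift2 c) (fun p => p + c) r.
Proof.
move=> Fr cp p pp; split; first exact: cp.
  by rewrite /shifted_drift2 !sine_drift_odd_pi// rmorphD.
move=> z zp; rewrite /shifted_drift2 rmorphD /=.
have -> (x : C) : x + c%:C - (p%:C + c%:C) = x - p%:C by ring.
have H := Fr p z pp zp.
have le2 : cmod (z - p%:C) / 2 <= cmod (z - p%:C) by have := cmod_ge0 (z - p%:C); lra.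
apply: le_trans (Fr _ _ pp (le_lt_trans (le_trans H le2) zp)) _.
by rewrite ler_pM2r//; apply: le_trans le2.
Qed.

(** Openness transports normality from [z] to [h z] off the critical points; at
    the remaining points, [h z] is known to be Fatou for another reason. *)
Lemma Fatou_forward h O : open O -> (forall w, O w -> open_at h w) ->
  (forall w, ~ O w -> Fatou h (h w)) -> forall z, Fatou h z -> Fatou h (h z).
Proof.
move=> oO hO hnO z Fz; have [Oz|/hnO//] := pselect (O z).
exact: Fatou_forward_open oO Oz hO Fz.
Qed.

Lemma open_noncritical : open [set z : C | 1 + ccos z != 0].
Proof.
apply/open_cmod => z /= z0; have L0 : 0 < cmod (1 + ccos z) by rewrite cmod_gt0.
have [d d0 dP] := (continuous_cmod _ _).1 (@continuous_ccos R z) _ L0.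
exists d => // w wz; apply/eqP => w0; have := dP w wz.
have -> : ccos w = -1 by apply/eqP; rewrite -addr_eq0 addrC w0.
have -> : -1 - ccos z = - (1 + ccos z) by ring.
by rewrite cmodN ltxx.
Qed.

Lemma Fatou_forward_reflected c :
  (forall p, odd_pi p -> Fatou (reflected_drift c) (c - p)%:C) ->
  forall z, Fatou (reflected_drift c) z ->
    Fatou (reflected_drift c) (reflected_drift c z).
Proof.
move=> Fp; apply: (Fatou_forward open_noncritical) => w /=.
  by rewrite -oppr_eq0 => w0; exact: open_at_strict w0 (@reflected_drift_strict_deriv c w).
move/negP; rewrite negbK => /eqP/ccos_eqN1[p pp ->].
by rewrite /reflected_drift sine_drift_odd_pi// -rmorphB; exact: Fp.
Qed.

Lemma Fatou_forward_shifted c :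
  (forall p, odd_pi p -> Fatou (shifted_drift2 c) (p + c)%:C) ->
  forall z, Fatou (shifted_drift2 c) z ->
    Fatou (shifted_drift2 c) (shifted_drift2 c z).
Proof.
move=> Fp; pose O1 := [set z : C | 1 + ccos z != 0].
have oO : open (O1 `&` sine_drift @^-1` O1).
  apply: openI; first exact: open_noncritical.
  apply: open_comp; last exact: open_noncritical.
  by move=> z _; exact: continuous_sine_drift.
apply: (Fatou_forward oO) => w /=.
  move=> [w1 w2]; apply: (@open_at_comp _ (sine_drift \o sine_drift) (fun z => z + c%:C)).
    by apply: open_at_comp; exact: open_at_strict (@sine_drift_strict_deriv _).
  exact: open_at_strict (oner_neq0 _) (@translation_strict_deriv c _).
have step p : odd_pi p -> Fatou (shifted_drift2 c) (p%:C + c%:C).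
  by move=> pp; rewrite -rmorphD; exact: Fp.
move=> /not_andP[] /negP; rewrite negbK => /eqP/ccos_eqN1[p pp wp].
  by rewrite /shifted_drift2 wp !sine_drift_odd_pi//; exact: step.
by rewrite /shifted_drift2 wp sine_drift_odd_pi//; exact: step.
Qed.

End Maps.
(** * Orbits landing on the real axis *)

Section Shooting.
Variable R : realType.
Implicit Types (x y s t u : R) (q : R * R).

Lemma sin_mvt x : 0 <= x -> exists2 c, 0 <= c <= x & sin x = cos c * x.
Proof.
move=> x0; have [|c] := MVT_segment x0 (fun y _ => @is_derive_sin R y).
  by apply: continuous_subspaceT; exact: continuous_sin.
by rewrite in_itv /= sin0 !subr0 => cx sE; exists c.
Qed.

Lemma norm_sin_le x : `|sin x| <= `|x|.
Proof.
wlog x0 : x / 0 <= x => [hw|].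
  have [/hw//|/ltW x0] := leP 0 x.
  by rewrite -normrN -sinN -[leRHS]normrN; apply: hw; rewrite oppr_ge0.
have [c _ ->] := sin_mvt x0.
by rewrite normrM ler_piMl// cos_max.
Qed.

Lemma cos_half x : cos x = 1 - sin (x / 2) ^+ 2 *+ 2.
Proof.
have {1}-> : x = x / 2 *+ 2 by rewrite -mulr_natr divfK// pnatr_eq0.
by rewrite cos_mulr2n sin2cos2 mulrnBl mulr2n; ring.
Qed.

Lemma cos_ge_quadratic x : 1 - x ^+ 2 / 2 <= cos x.
Proof.
rewrite cos_half lerD2l lerN2.
have -> : x ^+ 2 / 2 = (x / 2) ^+ 2 *+ 2 by rewrite -mulr_natr; field.
rewrite lerMn2r -(real_normK (num_real (sin _))) -(real_normK (num_real (x / 2))).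
by rewrite ler_sqr ?nnegrE ?norm_sin_le.
Qed.

(** With [v = x / 2], the mean value theorem gives [v * cos v <= sin v], so
    [sin x = 2 sin v cos v >= x * cos v ^ 2], and [cos v ^ 2 >= 1 / 2] because
    [cos x >= 0]. *)
Lemma sin_ge_half x : 0 <= x <= pi / 2 -> x / 2 <= sin x.
Proof.
move=> /andP[x0 xpi]; have h0 : 0 <= x / 2 by rewrite divr_ge0.
have pi0 := pi_gt0 R.
have [c /andP[c0 cx] sE] := sin_mvt h0.
have cosc : cos (x / 2) <= cos c.
  have [->//|cx'] := eqVneq c (x / 2).
  apply/ltW; rewrite ltr_cos ?in_itv /= ?c0 ?h0 /=; [|lra|lra].
  by rewrite lt_neqAle cx'.
have cosx : 0 <= cos x by apply: cos_ge0_pihalf; apply/andP; split => //; lra.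
have cosh0 : 0 <= cos (x / 2) by apply: cos_ge0_pihalf; apply/andP; split; lra.
have -> : sin x = 2 * (cos (x / 2) * sin (x / 2)).
  have {1}-> : x = x / 2 *+ 2 by rewrite -mulr_natr divfK// pnatr_eq0.
  by rewrite sin_mulr2n mulr2n; ring.
have cos2 : 1 / 2 <= cos (x / 2) * cos (x / 2).
  have : cos x = cos (x / 2) ^+ 2 *+ 2 - 1.
    have {1}-> : x = x / 2 *+ 2 by rewrite -mulr_natr divfK// pnatr_eq0.
    by rewrite cos_mulr2n.
  by rewrite mulr2n; move: cosx; rewrite expr2; lra.
rewrite sE; have := ler_wpM2l cosh0 cosc => H.
have := ler_wpM2r h0 (le_trans cos2 H); lra.
Qed.

Lemma sh_ge x : 0 <= x -> x <= sh x.
Proof.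
move=> x0; have [|c _] := MVT_segment x0 (fun y _ => @is_derive_sh R y).
  by apply: continuous_subspaceT; exact: continuous_sh.
rewrite sh0 !subr0 => ->; rewrite ler_peMl//; exact: ch_ge1.
Qed.

Lemma expR_ge_quadratic x : 0 <= x -> 1 + x ^+ 2 / 2 <= expR x.
Proof. exact: (@expR_ge1Dxn R x 1). Qed.

Lemma sh_ge_quadratic x : 0 <= x -> x ^+ 2 / 4 <= sh x.
Proof.
move=> x0; have := expR_ge_quadratic x0; rewrite /sh.
have : expR (- x) <= 1 by rewrite expR_le1 oppr_le0.
lra.
Qed.

Lemma ch_ge_quadratic x : 0 <= x -> x ^+ 2 / 4 <= ch x.
Proof.
move=> x0; have := expR_ge_quadratic x0; rewrite /ch.
have := expR_gt0 (- x); lra.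
Qed.

Lemma bernoulli (a : R) n : 0 <= a -> 1 + n%:R * a <= (1 + a) ^+ n.
Proof.
move=> a0; elim: n => [|n IH]; first by rewrite mul0r addr0 expr0.
rewrite exprS -natr1; have H : 0 <= 1 + a by rewrite addr_ge0.
have := ler_wpM2l H IH; have : 0 <= n%:R * a * a by rewrite !mulr_ge0.
lra.
Qed.

(** The infimum of the points where [f] is at least [v]. *)
Lemma first_crossing (f : R -> R) b v : continuous f -> 0 <= b -> f 0 <= v ->
  v <= f b -> exists t, [/\ 0 <= t <= b, f t = v & forall s, 0 <= s <= t -> f s <= v].
Proof.
move=> cf b0 f0 fb; pose A := [set t | 0 <= t <= b /\ v <= f t].
have Ab : A b by rewrite /A /= b0 lexx.
have lbA : has_lbound A by exists 0 => t [/andP[]].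
have infA : has_inf A by split => //; exists b.
pose t := inf A.
have t0 : 0 <= t by apply: lb_le_inf; [exists b|move=> s [/andP[]]].
have tb : t <= b by apply: ge_inf.
have below s : 0 <= s -> s < t -> f s < v.
  move=> s0 st; rewrite ltNge; apply/negP => vs.
  have : t <= s by apply: ge_inf => //; split=> //; rewrite s0 (le_trans (ltW st) tb).
  by rewrite leNgt st.
have ft_ge : v <= f t.
  rewrite leNgt; apply/negP => ftv.
  have := cf t => /cvgrPdist_lt /(_ (v - f t)); rewrite subr_gt0 => /(_ ftv).
  move=> /nbhs_ballP[d /= d0 dP]; have [a [/andP[a0 ab] va] atd] := inf_adherent d0 infA.
  have ta : t <= a by apply: ge_inf => //; split=> //; rewrite a0.
  have /dP : ball t d a by rewrite /ball /= distrC ger0_norm ?subr_ge0// ltrBlDl.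
  by rewrite /= ltr_distlC => /andP[_]; move: va; lra.
have ftE : f t = v.
  apply/eqP; rewrite eq_le ft_ge andbT leNgt; apply/negP => ftv.
  have [||c] := @IVT R f 0 t v t0.
  - by apply: continuous_subspaceT => ?; exact: cf.
  - by rewrite ge_min f0 le_max ft_ge orbT.
  rewrite in_itv /= => /andP[c0]; rewrite le_eqVlt => /predU1P[->|ct] fc.
    by move: ftv; rewrite fc ltxx.
  by have := below c c0 ct; rewrite fc ltxx.
exists t; split=> //; first by rewrite t0.
move=> s /andP[s0]; rewrite le_eqVlt => /predU1P[->|st]; first by rewrite ftE.
exact/ltW/below.
Qed.

(** [sine_drift] in Cartesian coordinates. *)
Definition drift_step q : R * R :=
  (q.1 + sin q.1 * ch q.2, q.2 + cos q.1 * sh q.2).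

Definition drift_orbit y n t : R * R := iter n drift_step (t, y).

Lemma drift_orbitS y n t :
  drift_orbit y n.+1 t = drift_step (drift_orbit y n t).
Proof. by []. Qed.

Lemma continuous_drift_orbit y n :
  continuous (fun t => (drift_orbit y n t).1) /\
  continuous (fun t => (drift_orbit y n t).2).
Proof.
elim: n => [|n [cx cy]]; first by split=> t; [exact: cvg_id|exact: cvg_cst].
have comp (f g : R -> R) : continuous f -> continuous g -> continuous (g \o f).
  by move=> cf cg t; exact: (@continuous_comp R R R f g t (cf t) (cg (f t))).
have cM (f g : R -> R) : continuous f -> continuous g -> continuous (f \* g).
  by move=> cf cg t; exact: continuousM (cf t) (cg t).
have cD (f g : R -> R) : continuous f -> continuous g -> continuous (f + g).
  by move=> cf cg t; exact: continuousD (cf t) (cg t).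
split.
  apply: (cD _ _ cx (cM _ _ (comp _ _ cx (@continuous_sin R))
    (comp _ _ cy (@continuous_ch R)))).
apply: (cD _ _ cy (cM _ _ (comp _ _ cx (@continuous_cos R))
  (comp _ _ cy (@continuous_sh R)))).
Qed.

(** A bound slightly beyond [pi / 2]: between [pi / 2] and [wall], [cos] becomes
    negative, so the imaginary part can drop below zero, and
    [sin x >= 7 / 8 > 1 / 2], so that an orbit which has passed [pi / 2] is
    beyond [wall] at the next step. *)
Let wall : R := pi / 2 + 1 / 2.

Lemma sin_near_wall x : pi / 2 <= x <= wall -> 7 / 8 <= sin x.
Proof.
move=> /andP[x1 x2]; rewrite -cosBpihalf.
apply: le_trans (cos_ge_quadratic _); have : (x - pi / 2) ^+ 2 <= (1 / 2) ^+ 2.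
  by rewrite ler_sqr ?nnegrE; move: x2; rewrite /wall; lra.
lra.
Qed.

Lemma cos_wall : cos wall = - sin (1 / 2).
Proof. by rewrite /wall addrC cosDpihalf. Qed.

(** The orbit of [s + i y0] as long as its real part has not passed [wall]. *)
Section Strip.
Variables (y0 s : R) (n : nat).
Hypotheses (y00 : 0 < y0) (s0 : 0 <= s).
Hypothesis sw : forall j, (j <= n)%N -> (drift_orbit y0 j s).1 <= wall.
Let X j := (drift_orbit y0 j s).1.
Let Y j := (drift_orbit y0 j s).2.

Lemma orbit_re_ge0 j : (j <= n)%N -> 0 <= X j.
Proof.
elim: j => // j IH jn; have Xj := IH (ltnW jn); rewrite /X drift_orbitS /= addr_ge0//.
rewrite mulr_ge0// ?(ltW (ch_gt0 _))// sin_ge0_pi//; apply/andP; split=> //.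
apply: le_trans (sw (ltnW jn)) _; rewrite /wall; have := pi_ge2 R; lra.
Qed.

Lemma orbit_re_le_pihalf j : (j < n)%N -> X j <= pi / 2.
Proof.
move=> jn; rewrite leNgt; apply/negP => Xj.
have sinX : 7 / 8 <= sin (X j) by apply: sin_near_wall; rewrite (ltW Xj) sw// ltnW.
have := sw jn; rewrite drift_orbitS /= -/(X j) -/(Y j) /wall.
have := ler_wpM2l (le_trans (_ : 0 <= 7 / 8) sinX) (ch_ge1 (Y j)).
by rewrite mulr1 => /(_ ltac:(lra)); lra.
Qed.

Lemma orbit_re_growth j : (j < n)%N -> 3 / 2 * X j <= X j.+1.
Proof.
move=> jn; have X0 := orbit_re_ge0 (ltnW jn).
have sinX : X j / 2 <= sin (X j) by apply: sin_ge_half; rewrite X0 orbit_re_le_pihalf.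
rewrite /X drift_orbitS /= -/(X j) -/(Y j).
have := ler_wpM2l (le_trans (_ : 0 <= X j / 2) sinX) (ch_ge1 (Y j)).
by rewrite mulr1 => /(_ ltac:(lra)); lra.
Qed.

Lemma orbit_re_ge_pow j : (j <= n)%N -> (3 / 2) ^+ j * s <= X j.
Proof.
elim: j => [|j IH] jn; first by rewrite expr0 mul1r.
apply: le_trans (orbit_re_growth jn).
by rewrite exprS -mulrA ler_wpM2l ?IH ?(ltnW jn).
Qed.

Lemma orbit_im_mono j : (j <= n)%N -> y0 <= Y j /\ ((j < n)%N -> Y j <= Y j.+1).
Proof.
elim: j => [|j IH] jn.
  split=> // j0; rewrite /Y drift_orbitS /= lerDl mulr_ge0//; last first.
    by apply: le_trans (sh_ge (ltW y00)); exact: ltW.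
  apply: cos_ge0_pihalf; have : s <= pi / 2 := orbit_re_le_pihalf j0.
  by have := pi_ge0 R; have := s0 => ? ? ?; apply/andP; split; lra.
have [yj /(_ jn) yjS] := IH (ltnW jn); have yS := le_trans yj yjS.
split=> // jS; change (Y j.+1 <= Y j.+1 + cos (X j.+1) * sh (Y j.+1)).
have y1 : 0 <= Y j.+1 by apply: le_trans yS; exact: ltW.
rewrite lerDl mulr_ge0//; last exact: le_trans (sh_ge y1).
apply: cos_ge0_pihalf; have := orbit_re_le_pihalf jS; have := orbit_re_ge0 jn.
by have := pi_ge0 R => ? ? ?; apply/andP; split; lra.
Qed.

(** Here [X j.+1 <= pi / 2], so [X j <= (2 / 3) (pi / 2) < 4 / 3] and [cos (X j)]
    is bounded away from zero. *)
Lemma orbit_im_growth j : (j.+1 < n)%N -> Y j + y0 / 9 <= Y j.+1.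
Proof.
move=> jn; have jn1 := ltnW jn.
have X1 := orbit_re_le_pihalf jn; have Xg := orbit_re_growth jn1.
have X0 := orbit_re_ge0 (ltnW jn1); have pi4 := @pihalf_lt2 R.
have Xb : X j <= 4 / 3 by lra.
have cosX : 1 / 9 <= cos (X j).
  apply: le_trans (cos_ge_quadratic _).
  have : (X j) ^+ 2 <= (4 / 3) ^+ 2 by rewrite ler_sqr ?nnegrE//; lra.
  lra.
have [yj _] := orbit_im_mono (ltnW jn1).
rewrite /Y drift_orbitS /= -/(X j) -/(Y j) lerD2l.
have Y0 : 0 <= Y j := le_trans (ltW y00) yj.
have shY := le_trans yj (sh_ge Y0).
have := ler_pM (_ : 0 <= 1 / 9 :> R) (ltW y00) cosX shY.
by move=> /(_ ltac:(lra)); lra.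
Qed.

Lemma orbit_im_ge : y0 * (n%:R / 9) <= Y n.
Proof.
have H j : (j.+1 <= n)%N -> y0 * (j.+1%:R / 9) <= Y j.
  elim: j => [|j IH] jn.
    have [+ _] := orbit_im_mono (leq0n n); apply: le_trans.
    by rewrite ler_piMr ?(ltW y00)//; lra.
  apply: le_trans (orbit_im_growth jn).
  by have := IH (ltnW jn); rewrite -[j.+2%:R]natr1; lra.
case: n H sw orbit_im_mono => [|m] H swm mono.
  by rewrite mul0r mulr0 (le_trans (ltW y00))//; have [] := mono 0%N isT.
apply: le_trans (H m (leqnn _)) _.
by have [_] := mono m (leqnSn _); apply.
Qed.

End Strip.

Lemma drift_orbit_re0 y n : (drift_orbit y n 0).1 = 0.
Proof. by elim: n => //= n ->; rewrite sin0 mul0r addr0. Qed.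

(** At time [n.+1] the initial point [t] that hits [wall] at time [n] is already
    beyond it, whereas the initial point [0] remains on the imaginary axis; the
    next [t] is the first crossing between the two. Taking the first one keeps
    all smaller initial points in the strip. *)
Lemma wall_hit y n : exists t, [/\ 0 <= t <= wall, (drift_orbit y n t).1 = wall &
  forall s j, 0 <= s <= t -> (j <= n)%N -> (drift_orbit y j s).1 <= wall].
Proof.
have wall0 : 0 <= wall by have := pi_ge0 R; rewrite /wall; lra.
elim: n => [|n [t [/andP[t0 tw] tE tle]]].
  exists wall; split=> //; first by rewrite wall0 lexx.
  by move=> s [|//] /andP[].
have [|||u [/andP[u0 ut] uE ule]] :=
    @first_crossing (fun t => (drift_orbit y n.+1 t).1) t wall _ t0.
- by have [] := continuous_drift_orbit y n.+1.
- by rewrite drift_orbit_re0.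
- rewrite drift_orbitS /= tE lerDl mulr_ge0 ?(ltW (ch_gt0 _))//.
  have : 7 / 8 <= sin wall by apply: sin_near_wall; rewrite lexx andbT /wall; lra.
  lra.
exists u; split=> //; first by rewrite u0 (le_trans ut).
move=> s j /andP[s0 su]; rewrite leq_eqVlt => /predU1P[->|].
  by apply: ule; rewrite s0.
by rewrite ltnS; apply: tle; rewrite s0 (le_trans su).
Qed.

(** Between the initial points [0] and [t], where [t] hits [wall] at time [n], the
    imaginary part at time [n.+1] changes sign: it is nonnegative at [0], and at
    [t] it equals [y - sin (1 / 2) * sh y] with [y] large. At its zero the real
    part exceeds [pi / 2] at time [n], hence it is of the order of [ch y] one
    step later, whereas [y] grows at least linearly in [n]. *)
Lemma real_landing y0 (d : R) N : 0 < y0 -> 0 < d -> exists m s,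
  [/\ (N <= m)%N, 0 <= s < d, (drift_orbit y0 m s).2 = 0 &
      pi *+ 2 *+ m <= (drift_orbit y0 m s).1].
Proof.
move=> y00 d0; pose k : R := sin (1 / 2).
have k0 : 0 < k by apply: sin2_gt0; apply/andP; split; lra.
(* In turn, these bounds make [t] smaller than [d], the landing point larger
   than [2 pi n.+1], and the imaginary part nonpositive at [t]. *)
have [n [Nn n1 nd ny nk]] : exists n, [/\ (N <= n)%N, 1 <= n%:R :> R,
    6 < n%:R * d, 80 * 80 < n%:R * y0 ^+ 2 & 36 < n%:R * (k * y0)].
  pose M : R := 1 + 6 / d + 80 * 80 / y0 ^+ 2 + 36 / (k * y0).
  have h1 : 0 < 6 / d by rewrite divr_gt0.
  have h2 : 0 < 80 * 80 / y0 ^+ 2 by rewrite divr_gt0 ?mulr_gt0 ?exprn_gt0.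
  have h3 : 0 < 36 / (k * y0) by rewrite divr_gt0// mulr_gt0.
  have M0 : 0 <= M by rewrite /M; lra.
  have /andP[_ Mn] := truncn_itv M0.
  exists (maxn N (Num.trunc M).+1); set n := maxn _ _.
  have {Mn}Mn : M < n%:R by apply: lt_le_trans Mn _; rewrite ler_nat leq_maxr.
  split; first exact: leq_maxl.
  - by move: Mn; rewrite /M; lra.
  - by rewrite -ltr_pdivrMr//; move: Mn; rewrite /M; lra.
  - by rewrite -ltr_pdivrMr ?exprn_gt0//; move: Mn; rewrite /M; lra.
  - by rewrite -ltr_pdivrMr ?mulr_gt0//; move: Mn; rewrite /M; lra.
have [t [/andP[t0 tw] tE tle]] := wall_hit y0 n.
have strip s : 0 <= s <= t -> forall j, (j <= n)%N -> (drift_orbit y0 j s).1 <= wall.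
  by move=> st j; exact: tle.
have pi4 := @pihalf_lt2 R.
have y_ge s : 0 <= s <= t -> y0 * (n%:R / 9) <= (drift_orbit y0 n s).2.
  by move=> st; apply: orbit_im_ge (strip _ st) => //; case/andP: st.
have big : 0 < y0 * (n%:R / 9) by rewrite !mulr_gt0 ?invr_gt0//; lra.
have td : t < d.
  have tt : 0 <= t <= t by rewrite t0 lexx.
  have := orbit_re_ge_pow t0 (strip _ tt) (leqnn n); rewrite tE => H.
  have := @bernoulli (1 / 2) n ltac:(lra); rewrite (_ : 1 + 1 / 2 = 3 / 2); last by field.
  move=> /(ler_wpM2r t0) /le_trans /(_ H); rewrite /wall => H2.
  rewrite ltNge; apply/negP => dt; have : n%:R * d <= n%:R * t by rewrite ler_wpM2l.
  by move: H2 nd; lra.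
pose g s := (drift_orbit y0 n.+1 s).2.
have [||s] := @IVT R g 0 t 0 t0.
- by apply: continuous_subspaceT => ?; have [_] := continuous_drift_orbit y0 n.+1; apply.
- have h0 : 0 <= (0 : R) <= t by apply/andP.
  have g0 : 0 <= g 0.
    rewrite /g drift_orbitS /= drift_orbit_re0 cos0 mul1r.
    have Y0 := le_trans (ltW big) (y_ge _ h0).
    by rewrite addr_ge0// (le_trans _ (sh_ge Y0)).
  have tt : 0 <= t <= t by rewrite t0 lexx.
  have gt : g t <= 0.
    rewrite /g drift_orbitS /= tE cos_wall -/k.
    have := y_ge _ tt; set y := (drift_orbit y0 n t).2 => Yy.
    have Y0 := le_trans (ltW big) Yy.
    have := ler_wpM2l (ltW k0) (sh_ge_quadratic Y0) => H1.
    have H2 : 4 <= k * y by have := ler_wpM2l (ltW k0) Yy; move: nk; lra.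
    by have := ler_wpM2r Y0 H2; move: H1; lra.
  by rewrite ge_min gt orbT le_max g0.
rewrite in_itv /= => st gs; exists n.+1, s; split=> //.
- exact: leq_trans Nn (leqnSn n).
- by case/andP: st => -> /le_lt_trans /(_ td).
have Yy := y_ge _ st; have s0 : 0 <= s by case/andP: st.
have x0 := orbit_re_ge0 s0 (strip _ st) (leqnn n).
have xw := strip _ st n (leqnn n).
move: gs; rewrite /g !drift_orbitS /=.
move: x0 xw Yy; set x := (drift_orbit y0 n s).1; set y := (drift_orbit y0 n s).2.
move=> x0 xw Yy gs; have Y0 := le_trans (ltW big) Yy.
have xpi : pi / 2 <= x.
  rewrite leNgt; apply/negP => xpi.
  have cosx : 0 <= cos x.
    by apply: cos_ge0_pihalf; have := pi_ge0 R => ?; apply/andP; split; lra.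
  have : 0 <= cos x * sh y by rewrite mulr_ge0// (le_trans _ (sh_ge Y0)).
  by move: gs big Yy; lra.
have sinx : 7 / 8 <= sin x by apply: sin_near_wall; rewrite xpi.
have y2 : (y0 * (n%:R / 9)) ^+ 2 <= y ^+ 2 by rewrite ler_sqr ?nnegrE// ltW.
have chy := le_trans (_ : _ <= y ^+ 2 / 4) (ch_ge_quadratic Y0).
have H1 : (y0 * (n%:R / 9)) ^+ 2 / 4 <= ch y by apply: chy; lra.
have H2 := ler_pM (_ : 0 <= 7 / 8 :> R) (_ : 0 <= (y0 * (n%:R / 9)) ^+ 2 / 4) sinx H1.
have {}H2 : 7 / 8 * ((y0 * (n%:R / 9)) ^+ 2 / 4) <= sin x * ch y.
  by apply: H2; [lra|rewrite divr_ge0// sqr_ge0].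
have n0 : 0 <= n%:R :> R by [].
have H3 := ler_wpM2l n0 (ltW ny).
have H4 : pi *+ 2 *+ n.+1 <= 16 * n%:R :> R.
  rewrite -mulr_natr -[pi *+ 2]mulr_natr -natr1.
  have : pi * (2 * (n%:R + 1)) <= 4 * (2 * (n%:R + 1)) :> R.
    by apply: ler_wpM2r; [rewrite mulr_ge0// addr_ge0|lra].
  by move: n1; lra.
by move: H2 H3 H4; lra.
Qed.

End Shooting.
(** * Vertical lines without Fatou points *)

Section VerticalLines.
Variable R : realType.
Local Notation C := (R[i]^o).
Implicit Types (z w : C) (c y t : R) (h : C -> C).
Local Notation Re := (@complex.Re R).
Local Notation Im := (@complex.Im R).

Lemma iter_sine_drift n t y :
  iter n (@sine_drift R) (t +i* y) =
  (drift_orbit y n t).1 +i* (drift_orbit y n t).2.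
Proof. by elim: n => //= n ->. Qed.

Definition drift_period t := forall z, sine_drift (z + t%:C) = sine_drift z + t%:C.

Lemma drift_period2pi : drift_period (pi *+ 2).
Proof. exact: sine_drift2pi. Qed.

Lemma drift_periodD t u : drift_period t -> drift_period u -> drift_period (t + u).
Proof. by move=> ht hu z; rewrite rmorphD /= !addrA hu ht. Qed.

Lemma drift_periodN t : drift_period t -> drift_period (- t).
Proof.
move=> ht z; apply: (addIr t%:C).
by rewrite -ht rmorphN /= !subrK.
Qed.

Lemma drift_periodMn t n : drift_period t -> drift_period (t *+ n).
Proof.
move=> ht; elim: n => [z|n IH]; first by rewrite mulr0n !addr0.
by rewrite mulrS; exact: drift_periodD.
Qed.

Lemma iter_shifted_drift2 c n z : drift_period c ->
  iter n (shifted_drift2 c) z = iter n.*2 (@sine_drift R) z + (c *+ n)%:C.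
Proof.
move=> hc; elim: n => [|n IH]; first by rewrite /= mulr0n addr0.
rewrite iterS IH doubleS !iterS /shifted_drift2 !(drift_periodMn n hc).
by rewrite mulrSr rmorphD /= addrA.
Qed.

Lemma shifted_drift2_period c t z : drift_period t ->
  shifted_drift2 c (z + t%:C) = shifted_drift2 c z + t%:C.
Proof. by move=> ht; rewrite /shifted_drift2 !ht addrAC. Qed.

Definition returns_near h z := exists M : R, forall (e : R) (N : nat), 0 < e ->
  exists n w, [/\ (N <= n)%N, cmod (w - z) < e & cmod (iter n h w) <= M].

Lemma returns_near_isometry h h' (rho : C -> C) z :
  (forall a b, cmod (rho a - rho b) = cmod (a - b)) ->
  (forall a, cmod (rho a) = cmod a) ->
  (forall a, h' (rho a) = rho (h a)) -> returns_near h z -> returns_near h' (rho z).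
Proof.
move=> rB r0 hr [M MP]; exists M => e N e0; have [n [w [Nn wz hw]]] := MP e N e0.
exists n, (rho w); rewrite rB; split=> //.
suff -> : iter n h' (rho w) = rho (iter n h w) by rewrite r0.
by elim: (n) => //= m ->.
Qed.

Lemma returns_near_translation h t z : (forall w, h (w + t%:C) = h w + t%:C) ->
  returns_near h z -> returns_near h (z + t%:C).
Proof.
move=> ht [M MP]; exists (M + `|t|) => e N e0; have [n [w [Nn wz hw]]] := MP e N e0.
exists n, (w + t%:C); split=> //; first by have -> : w + t%:C - (z + t%:C) = w - z by ring.
have -> : iter n h (w + t%:C) = iter n h w + t%:C by elim: (n) => //= m ->.
by apply: le_trans (cmodD _ _) _; rewrite cmod_real lerD.
Qed.

(** Since [sin] is periodic and [|sin u| <= |u|], the displacement [sin b] of a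
    real number [b] is at most its distance to either endpoint. *)
Lemma iter_sine_drift_real (a : R) m n : pi *+ 2 *+ m <= a <= pi *+ 2 *+ m.+1 ->
  exists2 b : R, pi *+ 2 *+ m <= b <= pi *+ 2 *+ m.+1 &
    iter n (@sine_drift R) a%:C = b%:C.
Proof.
move=> am; elim: n => [|n [b /andP[bm bM] IH]]; first by exists a.
exists (b + sin b); last first.
  rewrite iterS IH; apply: ReIm_eq; rewrite /= ?ch0 ?sh0; ring.
have sin_per (x : R) k : sin (x - pi *+ 2 *+ k) = sin x.
  by rewrite -[in RHS](subrK (pi *+ 2 *+ k) x) (periodicn (@sinD2pi R)).
have := norm_sin_le (b - pi *+ 2 *+ m); rewrite sin_per [leRHS]ger0_norm ?subr_ge0//.
have := norm_sin_le (b - pi *+ 2 *+ m.+1); rewrite sin_per [leRHS]ler0_norm ?subr_le0//.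
by rewrite !ler_norml => /andP[? ?] /andP[? ?]; apply/andP; split; lra.
Qed.

(** After landing at [a] with [2 pi m <= a <= 2 pi m.+1] and [m] large, the orbit
    is followed up to time [m], when the translations have brought this interval
    to [[0, 2 pi]]. *)
Lemma returns_near_imaginary_axis y : 0 < y ->
  returns_near (shifted_drift2 (- (pi *+ 2))) (0 +i* y).
Proof.
move=> y0; have pi20 : 0 < pi *+ 2 :> R by rewrite mulrn_wgt0// pi_gt0.
exists (pi *+ 2) => e N e0; have [k [s [Nk /andP[s0 se] im0 re]]] := real_landing N y0 e0.
set a := (drift_orbit y k s).1 in re.
have a0 : 0 <= a / (pi *+ 2).
  by rewrite divr_ge0 ?(ltW pi20)//; apply: le_trans re; rewrite mulrn_wge0// ltW.
pose m := Num.trunc (a / (pi *+ 2)).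
have km : (k <= m)%N.
  by rewrite /m truncn_ge_nat// ler_pdivlMr// mulr_natl.
have am : pi *+ 2 *+ m <= a <= pi *+ 2 *+ m.+1.
  have /andP[] := truncn_itv a0; rewrite -/m ler_pdivlMr// ltr_pdivrMr//.
  by rewrite !mulr_natl => -> /ltW.
exists m, (s +i* y); split; first exact: leq_trans km.
  have -> : (s +i* y : C) - (0 +i* y) = s%:C.
    by apply: ReIm_eq; rewrite /= ?subr0 ?subrr.
  by rewrite cmod_real ger0_norm.
rewrite iter_shifted_drift2; last exact: drift_periodN drift_period2pi.
have km2 : (k <= m.*2)%N by rewrite (leq_trans km)// -addnn leq_addl.
(* The second iterate is taken [m] times, and the landing occurred at a time
   [k <= m]. *)
rewrite -(subnK km2) iterD iter_sine_drift -/a im0.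
have [b /andP[bm bM] ->] := iter_sine_drift_real (m.*2 - k) am.
rewrite -rmorphD /= cmod_real mulNrn ger0_norm ?subr_ge0//.
by move: bM; rewrite mulrSr; lra.
Qed.

Lemma sine_drift_conj z : sine_drift (z^*)%C = (sine_drift z)^*%C :> C.
Proof.
case: z => a b; apply: ReIm_eq; rewrite /= ?chN ?shN//.
by rewrite mulrN opprD.
Qed.

(** Translations by periods reduce the vertical lines to the imaginary axis,
    complex conjugation exchanges its two halves, and [z |-> - z] exchanges the
    two signs of [c]. *)
Lemma returns_near_vertical_line c t y : c = pi *+ 2 \/ c = - (pi *+ 2) ->
  drift_period t -> y != 0 -> returns_near (shifted_drift2 c) (t +i* y).
Proof.
move=> cE tp y0; have -> : t +i* y = (0 +i* y : C) + t%:C.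
  by apply: ReIm_eq; rewrite /= ?add0r ?addr0.
apply: returns_near_translation => [w|]; first exact: shifted_drift2_period.
have conj (a : C) : cmod (a^*)%C = cmod a.
  by rewrite !cmodE; case: a => u v /=; rewrite sqrrN.
have neg y' : y' != 0 -> returns_near (shifted_drift2 (- (pi *+ 2))) (0 +i* y').
  rewrite neq_lt => /orP[y'0|]; last exact: returns_near_imaginary_axis.
  have -> : 0 +i* y' = ((0 +i* - y' : C)^*)%C by apply: ReIm_eq; rewrite /= ?opprK.
  apply: (@returns_near_isometry (shifted_drift2 (- (pi *+ 2))) _ conjc) => //.
  - by move=> a b; rewrite -rmorphB conj.
  - move=> a; rewrite /shifted_drift2 !sine_drift_conj; case: (sine_drift _) => u v.
    by apply: ReIm_eq; rewrite //= !addr0.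
  - by apply: returns_near_imaginary_axis; rewrite oppr_gt0.
case: cE => ->; last exact: neg.
have -> : 0 +i* y = - (0 +i* - y : C) by apply: ReIm_eq; rewrite /= ?opprK ?oppr0.
apply: (@returns_near_isometry (shifted_drift2 (- (pi *+ 2))) _ (fun z => - z)).
- by move=> a b; rewrite -opprD cmodN.
- exact: cmodN.
- move=> a; rewrite /shifted_drift2 !sine_driftN; case: (sine_drift _) => u v.
    apply: ReIm_eq => /=; ring.
- by apply: neg; rewrite oppr_eq0.
Qed.

(** The line is invariant up to the translations, so its points escape; the one
    point [y = 0] is dealt with by openness of the Fatou set. *)
Lemma not_Fatou_vertical_line c z : c = pi *+ 2 \/ c = - (pi *+ 2) ->
  drift_period (Re z) -> ~ Fatou (shifted_drift2 c) z.
Proof.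
move=> cE; case: z => t y /= tp.
suff {y} off y : y != 0 -> ~ Fatou (shifted_drift2 c) (t +i* y).
  have [->|] := eqVneq y 0; last exact: off.
  move=> /((open_cmod _).1 (@Fatou_open R _))[r r0 rF].
  apply: (off (r / 2)); first by rewrite mulf_neq0 ?invr_eq0 ?gt_eqF.
  apply: rF; have -> : (t +i* (r / 2) : C) - (t +i* 0) = 0 +i* (r / 2).
    by apply: ReIm_eq; rewrite /= ?subrr ?subr0.
  rewrite cmodE /= expr0n add0r sqrtr_sqr ger0_norm ?divr_ge0 ?(ltW r0)//.
  by rewrite ltr_pdivrMr// ltr_pMr// ltr1n.
move=> y0; have pi20 : 0 < pi *+ 2 :> R by rewrite mulrn_wgt0// pi_gt0.
have cp : drift_period c.
  by case: cE => ->; [|apply: drift_periodN]; exact: drift_period2pi.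
have nc : `|c| = pi *+ 2.
  by case: cE => ->; rewrite ?normrN gtr0_norm.
have [M MP] := returns_near_vertical_line cE tp y0.
apply: (not_Fatou_escaping (@continuous_shifted_drift2 R c) _ MP) => K.
pose L := (`|K| + `|t|) / (pi *+ 2).
have L0 : 0 <= L by apply: divr_ge0; [exact: addr_ge0|exact: ltW].
exists (Num.trunc L).+1 => // n /= Ln.
have {}Ln : L < n%:R.
  have /andP[_ /lt_le_trans] := truncn_itv L0; apply.
  by rewrite ler_nat.
apply: lt_le_trans (abs_Re_le _).
have -> : t +i* y = (0 +i* y : C) + t%:C.
  by apply: ReIm_eq; rewrite /= ?add0r ?addr0.
have -> : iter n (shifted_drift2 c) ((0 +i* y : C) + t%:C) =
    iter n (shifted_drift2 c) (0 +i* y) + t%:C.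
  by elim: (n) => //= k ->; exact: shifted_drift2_period.
rewrite iter_shifted_drift2// iter_sine_drift /= drift_orbit_re0 add0r.
have : `|c *+ n| <= `|c *+ n + t| + `|t|.
  by rewrite -[in leLHS](addrK t (c *+ n)) ler_normB.
rewrite normrMn nc; move: Ln; rewrite ltr_pdivrMr// mulr_natl.
by have := ler_norm K; lra.
Qed.

End VerticalLines.
(** * Fatou components *)

Section Components.
Variable R : realType.
Local Notation C := (R[i]^o).
Implicit Types (z w : C) (c t p : R) (h : C -> C).
Local Notation Re := (@complex.Re R).
Local Notation Im := (@complex.Im R).

(** A continuous image of a component is connected, and forward invariance keeps
    it inside the Fatou set. *)
Lemma component_of_iterate h z k : continuous h ->
  (forall w, Fatou h w -> Fatou h (h w)) -> Fatou h z ->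
  component_of_image h (connected_component (Fatou h) z) k
    (connected_component (Fatou h) (iter k h z)).
Proof.
move=> ch hF Fz; have Fiter w : Fatou h w -> Fatou h (iter k h w).
  by elim: k => //= k IH Fw; apply: hF; exact: IH.
split; first by exists (iter k h z) => //; exact: Fiter.
apply: connected_component_max.
- by exists z => //; exact: connected_component_refl.
- by move=> _ [w /connected_component_sub Fw <-]; exact: Fiter.
- apply: connected_continuous_connected; first exact: component_connected.
  by apply: continuous_subspaceT; exact: continuous_iter.
Qed.

Lemma disk_in_component h p (r : R) : cball (p%:C : C) r `<=` Fatou h -> 0 < r ->
  cball (p%:C : C) r `<=` connected_component (Fatou h) p%:C.
Proof.
move=> rF r0; apply: connected_component_max => //; first exact: cball_center.
exact: cball_connected.
Qed.

(** A common component would be a connected set meeting the line [Re z = t]. *)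
Lemma disjoint_components c t p q : c = pi *+ 2 \/ c = - (pi *+ 2) ->
  drift_period t -> p < t < q ->
  Fatou (shifted_drift2 c) p%:C -> Fatou (shifted_drift2 c) q%:C ->
  connected_component (Fatou (shifted_drift2 c)) p%:C `&`
  connected_component (Fatou (shifted_drift2 c)) q%:C = set0.
Proof.
move=> cE tp /andP[pt tq] Fp Fq; apply/seteqP; split=> // w [wp wq].
pose U := connected_component (Fatou (shifted_drift2 c)) p%:C.
have Uq : U q%:C.
  apply: connected_component_trans wp _.
  exact: connected_component_sym.
have Up : U p%:C by exact: connected_component_refl.
have : is_interval (Re @` U).
  apply/connected_intervalP; apply: connected_continuous_connected.
    exact: component_connected.
  by apply: continuous_subspaceT; exact: continuous_Re.
move=> iU; have [z Uz zt] : (Re @` U) t.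
  apply: (iU p q); [by exists p%:C|by exists q%:C|by rewrite (ltW pt) (ltW tq)].
apply: (@not_Fatou_vertical_line R c z cE); first by rewrite zt.
exact: connected_component_sub Uz.
Qed.

Lemma wandering_shifted c : c = pi *+ 2 \/ c = - (pi *+ 2) ->
  (forall p, odd_pi p -> Fatou (shifted_drift2 c) p%:C) ->
  wandering_component (shifted_drift2 c)
    (connected_component (Fatou (shifted_drift2 c)) (pi : R)%:C).
Proof.
move=> cE Fp; have oddpi : odd_pi (pi : R) by rewrite /odd_pi cospi.
have pi0 := pi_gt0 R.
have oddc p : odd_pi p -> odd_pi (p + c).
  by case: cE => ->; [exact: odd_piD2pi|exact: odd_piB2pi].
have oddk k : odd_pi (pi + c *+ k).
  by elim: k => [|k IH]; rewrite ?mulr0n ?addr0// mulrSr addrA; exact: oddc.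
have iterk k : iter k (shifted_drift2 c) (pi : R)%:C = (pi + c *+ k)%:C.
  elim: k => [|k IH]; first by rewrite mulr0n addr0.
  by rewrite iterS IH /shifted_drift2 !sine_drift_odd_pi// mulrSr addrA [in RHS]rmorphD.
have fwd z : Fatou (shifted_drift2 c) z -> Fatou (shifted_drift2 c) (shifted_drift2 c z).
  by apply: Fatou_forward_shifted => p /oddc; exact: Fp.
split; first by exists (pi : R)%:C => //; exact: Fp.
exists (fun k => connected_component (Fatou (shifted_drift2 c)) (pi + c *+ k)%:C).
split=> [k|k l].
  rewrite -iterk; apply: component_of_iterate => //; last exact: Fp.
  exact: continuous_shifted_drift2.
have per j : drift_period (pi *+ 2 *+ j : R).
  by apply: drift_periodMn; exact: drift_period2pi.
have disj m n : (m < n)%N ->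
    connected_component (Fatou (shifted_drift2 c)) (pi + c *+ m)%:C `&`
    connected_component (Fatou (shifted_drift2 c)) (pi + c *+ n)%:C = set0.
  move=> mn; have le_mn : pi *+ 2 *+ m.+1 <= pi *+ 2 *+ n :> R.
    by rewrite ler_wpMn2l// mulrn_wge0// ltW.
  have [cp|cn] := cE.
    apply: (@disjoint_components c (pi *+ 2 *+ m.+1)) => //; try exact: Fp.
    move: le_mn; rewrite cp mulrSr => le_mn.
    by apply/andP; split; lra.
  rewrite setIC; apply: (@disjoint_components c (- (pi *+ 2 *+ m))) => //; try exact: Fp.
    by apply: drift_periodN.
  move: le_mn; rewrite cn mulrSr !mulNrn => le_mn.
  by apply/andP; split; lra.
case: (ltngtP k l) => // kl _; first exact: disj.
by rewrite setIC; exact: disj.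
Qed.

(** A polynomial equal to this map would make [csin] a polynomial with infinitely
    many zeros. *)
Lemma reflected_drift_transcendental c :
  transcendental_entire (reflected_drift c : C -> C).
Proof.
split; first exact: reflected_drift_entire.
move=> [P PE]; pose Q : {poly R[i]} := c%:C%:P - 'X - P.
have QE z : Q.[z] = csin z.
  by rewrite /Q !hornerE -PE /reflected_drift /sine_drift; ring.
have sin_zero n : csin (pi *+ n : R)%:C = 0.
  have sn : sin (pi *+ n : R) = 0.
    by elim: n => [|n IH]; rewrite ?mulr0n ?sin0// mulrSr sinD IH sinpi mul0r mulr0 addr0.
  by apply: ReIm_eq; rewrite /= ?sn ?sh0 ?mul0r ?mulr0.
have Q0 : Q = 0.
  apply/eqP/negPn/negP => Qn0.
  pose zeros : seq R[i] := [seq (pi *+ n : R)%:C | n <- iota 0 (size Q)].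
  suff : (size zeros < size Q)%N by rewrite size_map size_iota ltnn.
  apply: max_poly_roots => //.
    by apply/allP => _ /mapP[n _ ->]; rewrite rootE QE sin_zero.
  rewrite map_inj_uniq ?iota_uniq// => m n /complexI.
  by apply: mulrIn; rewrite gt_eqF ?pi_gt0.
have := QE (pi / 2)%:C; rewrite Q0 horner0 => /(congr1 Re) /=.
by rewrite sin_pihalf ch0 mul1r => /eqP; rewrite eq_sym oner_eq0.
Qed.

Lemma infinite_disks z (r : R) : 0 < r ->
  infinite_set (range (fun n : nat => cball z (r / n.+1%:R))).
Proof.
move=> r0; have lt_neq m n : (m < n)%N -> cball z (r / m.+1%:R) <> cball z (r / n.+1%:R).
  move=> mn E; have : cball z (r / m.+1%:R) (z + (r / n.+1%:R)%:C).
    rewrite /cball /= addrC addKr cmod_real ger0_norm ?divr_ge0 ?(ltW r0)//.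
    by rewrite ltr_pM2l// ltf_pV2 ?posrE// ltr_nat.
  rewrite E /cball /= addrC addKr cmod_real ger0_norm ?divr_ge0 ?(ltW r0)//.
  by rewrite ltxx.
have inj : {in [set: nat] &, injective (fun n : nat => cball z (r / n.+1%:R))}.
  by move=> m n _ _ E; case: (ltngtP m n) => // /lt_neq; [|move/nesym].
rewrite (eq_finite_set (inj_card_eq inj)); exact: infinite_nat.
Qed.

End Components.

Theorem theorem2p3 (R : realType) :
  exists f g : R[i]^o -> R[i]^o,
    transcendental_entire f /\ transcendental_entire g /\
    exists S : set (set R[i]^o), infinite_set S /\
      forall D, S D ->
        [/\ domain D,
            lies_in (periodic_component f) D,
            lies_in (periodic_component g) D,
            lies_in (wandering_component (g \o f)) D &
            lies_in (wandering_component (f \o g)) D].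
Proof.
exists (reflected_drift 0), (reflected_drift (pi *+ 2)).
split; first exact: reflected_drift_transcendental.
split; first exact: reflected_drift_transcendental.
have [r r0 Fr] := sine_drift_contracts R.
exists (range (fun n : nat => cball (pi : R)%:C (r / n.+1%:R))).
split=> [|_ [n _ <-]]; first exact: infinite_disks.
set D := cball _ _; have oddpi : odd_pi (pi : R) by rewrite /odd_pi cospi.
have pi0 := pi_gt0 R.
have rn0 : 0 < r / n.+1%:R by rewrite divr_gt0.
have Dr : D `<=` cball (pi : R)%:C r.
  move=> w /lt_le_trans; apply; rewrite ler_piMr ?(ltW r0)//.
  by rewrite invf_le1// ler1n.
have periodic c : (forall p : R, odd_pi p -> odd_pi (c - p)) ->
    lies_in (periodic_component (reflected_drift c)) D.
  move=> cp; have ctr := reflected_contracts Fr cp.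
  have disk p : odd_pi p -> cball (p%:C : R[i]^o) r `<=` Fatou (reflected_drift c).
    by move=> pp; apply: (Fatou_cycle r0 ctr pp); rewrite subKr.
  have Fp p : odd_pi p -> Fatou (reflected_drift c) p%:C.
    by move=> /disk; apply; exact: cball_center.
  have fwd := Fatou_forward_reflected (fun p pp => Fp _ (cp p pp)).
  exists (connected_component (Fatou (reflected_drift c)) (pi : R)%:C).
    split; first by exists (pi : R)%:C => //; exact: Fp.
    exists 2%N => //; have {2}-> : (pi : R)%:C = iter 2 (reflected_drift c) (pi : R)%:C.
      by have [_ -> _] := contracts_odd_pi_iter 2 ctr oddpi (cball_center _ r0);
        rewrite /= subKr.
    apply: component_of_iterate => //; last exact: Fp.
    exact: continuous_reflected_drift.
  exact: subset_trans Dr (disk_in_component (disk _ oddpi) r0).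
have wandering c : c = pi *+ 2 \/ c = - (pi *+ 2) ->
    lies_in (wandering_component (shifted_drift2 c)) D.
  move=> cE; have cp p : odd_pi p -> odd_pi (p + c).
    by case: cE => ->; [exact: odd_piD2pi|exact: odd_piB2pi].
  have ctr := shifted_contracts Fr cp.
  have iterE p k : iter k (fun p => p + c) p = p + c *+ k.
    by elim: k => [|k IH]; rewrite ?mulr0n ?addr0// iterS IH mulrSr addrA.
  have nc : `|c| = pi *+ 2.
    by case: cE => ->; rewrite ?normrN gtr0_norm// mulrn_wgt0.
  have disk p : odd_pi p -> cball (p%:C : R[i]^o) r `<=` Fatou (shifted_drift2 c).
    move=> pp; apply: (Fatou_escaping r0 ctr pp) => K.
    have pi20 : 0 < pi *+ 2 :> R by rewrite mulrn_wgt0.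
    have L0 : 0 <= (`|K| + `|p|) / (pi *+ 2).
      by apply: divr_ge0; [exact: addr_ge0|rewrite mulrn_wge0// ltW].
    exists (Num.trunc ((`|K| + `|p|) / (pi *+ 2))).+1 => // k /= Lk; rewrite iterE.
    have : (`|K| + `|p|) / (pi *+ 2) < k%:R.
      by have /andP[_ /lt_le_trans] := truncn_itv L0; apply; rewrite ler_nat.
    rewrite ltr_pdivrMr// mulr_natl.
    have : `|c *+ k| <= `|p + c *+ k| + `|p|.
      by rewrite -[in leLHS](addKr p (c *+ k)) addrC ler_normB.
    by rewrite normrMn nc; have := ler_norm K; lra.
  exists (connected_component (Fatou (shifted_drift2 c)) (pi : R)%:C).
    by apply: wandering_shifted => // p /disk; apply; exact: cball_center.
  exact: subset_trans Dr (disk_in_component (disk _ oddpi) r0).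
split.
- by split; [exists (pi : R)%:C; exact: cball_center|exact: cball_open|
    exact: cball_connected].
- by apply: periodic => p; rewrite sub0r; exact: odd_piN.
- by apply: periodic => p /odd_piN /odd_piD2pi; rewrite addrC.
- by rewrite reflected_comp0; apply: wandering; left.
- by rewrite reflected_0comp; apply: wandering; right.
Qed.
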